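(* Let $n\ge 3$, let $p,q\in\mathbb{C}^n$ be linearly independent, let $\alpha,\beta\in\{1,\dots,n\}$, and let $P,Q:\mathbf{SO}(n)\to\mathbb{C}$ be the complex-valued functions $$P(x)=\sum_{j=1}^n p_j x_{j\alpha},\qquad Q(x)=\sum_{k=1}^n q_k x_{k\beta}.$$ Let the rational function $f(x)=P(x)/Q(x)$ be defined on the open and dense subset $W_Q=\{x\in\mathbf{SO}(n)\mid Q(x)\neq 0\}$ of $\mathbf{SO}(n)$. The function $f$ is harmonic if and only if $\alpha=\beta$, $(q,q)=0$ and $(p,q)=0$. It is proper biharmonic if and only if (a) $\alpha=\beta$, $(q,q)=0$, $(p,q)\neq 0$ and $n=4$, or (b) $\alpha\neq\beta$, $(q,q)=0$ and $(p,q)=0$.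
   Context: $\mathbf{SO}(n)=\{x\in\mathbf{GL}_n(\mathbb{R})\mid xx^t=I_n,\ \det x=1\}$; $x_{j\alpha}$ denotes the $(j,\alpha)$-entry (row $j$, column $\alpha$) of $x$. The group carries the biinvariant Riemannian metric induced by the scalar product $g(X,Y)=\mathrm{trace}(XY^t)$ on its Lie algebra. For $p,q\in\mathbb{C}^n$, $(p,q)=\sum_{k=1}^n p_kq_k$ is the complex-bilinear form. For a complex-valued function $f$ on an open subset of a Riemannian manifold, $\tau(f)=\mathrm{div}(\nabla f)$ is the Laplace-Beltrami operator (extended complex-linearly) and $\tau^2(f)=\tau(\tau(f))$. The function $f$ is harmonic if $\tau(f)=0$; it is proper biharmonic if $\tau^2(f)=0$ and $\tau(f)$ does not vanish identically. *)

(* Defs.v *)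
From HB Require Import structures.
From mathcomp Require Import all_boot all_order all_algebra.
From mathcomp Require Import all_classical all_reals all_analysis.
From mathcomp Require Import complex lra.

Set Implicit Arguments.
Unset Strict Implicit.
Unset Printing Implicit Defensive.

Import Order.TTheory GRing.Theory Num.Theory.
Import numFieldNormedType.Exports.

Local Open Scope classical_set_scope.
Local Open Scope complex_scope.
Local Open Scope ring_scope.

Definition SO (R : realType) (n : nat) : set 'M[R]_n :=
  [set x | x *m x^T = 1%:M /\ \det x = 1].

Definition so (R : realType) (n : nat) : set 'M[R]_n := [set X | X^T = - X].

(* Every tangent space T_x SO(n) = x so(n) is identified with so(n) by left
   translation.  In this trivialization the biinvariant metric is the constant
   scalar product below, and the bracket of left-invariant vector fields is the
   matrix commutator. *)
Definition metric (R : realType) (n : nat) (X Y : 'M[R]_n) : R :=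
  \tr (X *m Y^T).

Definition bracket (R : realType) (n : nat) (X Y : 'M[R]_n) : 'M[R]_n :=
  X *m Y - Y *m X.

Definition expmx (R : realType) (n : nat) (A : 'M[R]_n) : 'M[R]_n :=
  limn (series (fun k : nat => k`!%:R^-1 *: A ^+ k)).

(* Functions and vector fields on an open subset of SO(n) are represented by
   total maps on 'M[R]_n.  The curve s |-> x exp(sX) with X in so(n) stays in
   SO(n), so at x in SO(n) the derivative along the left-invariant field X only
   depends on the values on SO(n) near x. *)
Definition lderive (R : realType) (n : nat) (V : normedModType R)
    (u : 'M[R]_n -> V) (x X : 'M[R]_n) : V :=
  derive1 (fun s : R => u (x *m expmx (s *: X))) 0.

Definition grad (R : realType) (n : nat) (u : 'M[R]_n -> R) (x : 'M[R]_n) :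
    'M[R]_n :=
  get [set G : 'M[R]_n |
        so G /\ forall X, so X -> metric G X = lderive u x X].

(* Covariant derivative, in the direction X of so(n), of a vector field V given
   in the left trivialization.  On left-invariant fields the Levi-Civita
   connection of a biinvariant metric is half the bracket, see
   levi_civita_bracket. *)
Definition covariant (R : realType) (n : nat) (V : 'M[R]_n -> 'M[R]_n)
    (x X : 'M[R]_n) : 'M[R]_n :=
  lderive V x X + 2^-1 *: bracket X (V x).

(* For r < s these matrices form an orthonormal basis of so(n). *)
Definition so_frame (R : realType) (n : nat) (r s : 'I_n) : 'M[R]_n :=
  (Num.sqrt 2)^-1 *: (delta_mx r s - delta_mx s r).

Definition divergence (R : realType) (n : nat) (V : 'M[R]_n -> 'M[R]_n)
    (x : 'M[R]_n) : R :=
  \sum_(r < n) \sum_(s < n | (r < s)%N)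
    metric (covariant V x (so_frame R r s)) (so_frame R r s).

Definition laplacian (R : realType) (n : nat) (u : 'M[R]_n -> R)
    (x : 'M[R]_n) : R :=
  divergence (grad u) x.

Definition tau (R : realType) (n : nat) (f : 'M[R]_n -> R[i])
    (x : 'M[R]_n) : R[i] :=
  laplacian (fun y => complex.Re (f y)) x
    +i* laplacian (fun y => complex.Im (f y)) x.

Definition harmonic_on (R : realType) (n : nat) (W : set 'M[R]_n)
    (f : 'M[R]_n -> R[i]) : Prop :=
  forall x, W x -> tau f x = 0.

Definition proper_biharmonic_on (R : realType) (n : nat) (W : set 'M[R]_n)
    (f : 'M[R]_n -> R[i]) : Prop :=
  (forall x, W x -> tau (tau f) x = 0) /\ (exists x, W x /\ tau f x <> 0).

Definition bilin (R : realType) (n : nat) (p q : 'rV[R[i]]_n) : R[i] :=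
  \sum_(k < n) p 0 k * q 0 k.

Definition colform (R : realType) (n : nat) (p : 'rV[R[i]]_n) (alpha : 'I_n)
    (x : 'M[R]_n) : R[i] :=
  \sum_(j < n) p 0 j * (x j alpha)%:C.

Definition SO_nonzero (R : realType) (n : nat) (Q : 'M[R]_n -> R[i]) :
    set 'M[R]_n :=
  [set x | SO x /\ Q x <> 0].

Definition open_dense_in (T : topologicalType) (S W : set T) : Prop :=
  (exists O : set T, open O /\ W = S `&` O) /\ S `<=` closure W.

Section Checks.
Variables (R : realType) (n : nat).
Implicit Types X Y Z : 'M[R]_n.

Lemma metricC X Y : metric X Y = metric Y X.
Proof. by rewrite /metric -mxtrace_tr trmx_mul trmxK. Qed.

Lemma metricDl X Y Z : metric (X + Y) Z = metric X Z + metric Y Z.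
Proof. by rewrite /metric mulmxDl mxtraceD. Qed.

Lemma metricZl a X Y : metric (a *: X) Y = a * metric X Y.
Proof. by rewrite /metric -scalemxAl mxtraceZ. Qed.

Lemma metricE X Y : metric X Y = \sum_i \sum_j X i j * Y i j.
Proof.
apply: eq_bigr => i _; rewrite mxE; apply: eq_bigr => j _.
by rewrite mxE.
Qed.

Lemma metric_eq0 X : metric X X = 0 -> X = 0.
Proof.
rewrite metricE => /eqP; rewrite psumr_eq0 => [/allP h|i _]; last first.
  by apply: sumr_ge0 => j _; rewrite -expr2 sqr_ge0.
apply/matrixP => i j; rewrite mxE.
have /implyP /(_ isT) := h i (mem_index_enum i).
rewrite psumr_eq0 => [/allP k|k _]; last by rewrite -expr2 sqr_ge0.
have /implyP /(_ isT) := k j (mem_index_enum j).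
by rewrite mulf_eq0 orbb => /eqP.
Qed.

Lemma so_bracket X Y : so X -> so Y -> so (bracket X Y).
Proof.
rewrite /so /= /bracket => hX hY.
by rewrite linearB /= !trmx_mul hX hY !mulmxN !mulNmx !opprK opprB.
Qed.

Lemma metric_bracket X Y Z : so X -> so Y -> so Z ->
  metric (bracket X Y) Z = metric (bracket Y Z) X.
Proof.
rewrite /so /= /metric /bracket => hX hY hZ.
rewrite hX hZ !mulmxBl !mulmxN !linearB /= !linearN /=.
by rewrite (mxtrace_mulC (Y *m Z)) mulmxA -(mulmxA Y X Z) (mxtrace_mulC Y)
  -!mulmxA (mxtrace_mulC X) -!mulmxA.
Qed.

Lemma so_frame_so (r s : 'I_n) : so (so_frame R r s).
Proof.
by rewrite /so /= /so_frame linearZ /= linearB /= !trmx_delta -scalerN opprB.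
Qed.

Lemma metric_so_frame (r s r' s' : 'I_n) : (r < s)%N -> (r' < s')%N ->
  metric (so_frame R r s) (so_frame R r' s') = ((r == r') && (s == s'))%:R.
Proof.
move=> rs rs'.
have E (a b c d : 'I_n) : metric (delta_mx a b) (delta_mx c d)
    = ((a == c) && (b == d))%:R :> R.
  rewrite metricE (bigD1 a) //= (bigD1 b) //= big1 ?addr0.
    rewrite big1 => [|i /negbTE ia]; last first.
      by rewrite big1 // => j _; rewrite mxE ia /= mul0r.
    by rewrite !mxE !eqxx mul1r addr0.
  by move=> j /negbTE jb; rewrite mxE jb andbF mul0r.
have N (a b c d : 'I_n) : (a < b)%N -> (c < d)%N ->
    (a == d) && (b == c) = false.
  move=> ab cd; apply/negbTE/negP => /andP[/eqP ad /eqP bc].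
  by move: cd; rewrite -ad -bc ltnNge (ltnW ab).
have B (A B C : 'M[R]_n) : metric (A - B) C = metric A C - metric B C.
  by rewrite metricDl -scaleN1r metricZl mulN1r.
rewrite /so_frame metricZl metricC metricZl B metricC (metricC _ (_ - _)) !B.
rewrite !E (andbC (s == r')) (andbC (s == s')) (N _ _ _ _ rs rs') mulr0n subr0 sub0r opprK.
rewrite mulrA -invfM -expr2 sqr_sqrtr ?ler0n // -mulr2n -[X in _ * X]mulr_natl.
by rewrite mulKf // pnatr_eq0.
Qed.

Lemma metric_bracketN X Y Z : so X -> so Y -> so Z ->
  metric (bracket X Y) Z = - metric Y (bracket X Z).
Proof.
move=> hX hY hZ; have -> : bracket X Z = -1 *: bracket Z X.
  by rewrite scaleN1r opprB.
rewrite (metric_bracket hX hY hZ) (metric_bracket hY hZ hX) (metricC Y).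
by rewrite metricZl mulN1r opprK.
Qed.

(* Left-invariant fields have constant scalar products, so on them metric
   compatibility is the third hypothesis. *)
Lemma levi_civita_bracket (D : 'M[R]_n -> 'M[R]_n -> 'M[R]_n) :
  (forall X Y, so X -> so Y -> so (D X Y)) ->
  (forall X Y, so X -> so Y -> D X Y - D Y X = bracket X Y) ->
  (forall X Y Z, so X -> so Y -> so Z ->
     metric (D X Y) Z + metric Y (D X Z) = 0) ->
  forall X Y, so X -> so Y -> D X Y = 2^-1 *: bracket X Y.
Proof.
move=> Dso tors comp X Y hX hY.
have B (A B C : 'M[R]_n) : metric (A - B) C = metric A C - metric B C.
  by rewrite metricDl -scaleN1r metricZl mulN1r.
have K Z : so Z -> metric (D X Y) Z = 2^-1 * metric (bracket X Y) Z.
  move=> hZ.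
  have h1 := comp X Y Z hX hY hZ; have h2 := comp Y Z X hY hZ hX.
  have h3 := comp Z X Y hZ hX hY.
  have t1 := congr1 (fun A => metric A Z) (tors X Y hX hY).
  have t2 := congr1 (fun A => metric A X) (tors Y Z hY hZ).
  have t3 := congr1 (fun A => metric A Y) (tors Z X hZ hX).
  have c1 := metric_bracket hX hY hZ; have c2 := metric_bracket hY hZ hX.
  rewrite /= B in t1; rewrite /= B in t2; rewrite /= B in t3.
  rewrite (metricC Y) in h1; rewrite (metricC Z) in h2.
  rewrite (metricC X) in h3.
  by lra.
apply/eqP; rewrite -subr_eq0; apply/eqP/metric_eq0.
set Z := _ - _; have hZ : so Z.
  rewrite /so /= /Z linearB linearZ /= (Dso _ _ hX hY) (so_bracket hX hY).
  by rewrite scalerN opprB opprK addrC.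
by rewrite {1}/Z B metricZl K // subrr.
Qed.

End Checks.

(* Main.v *)
Require Import Defs.
From mathcomp Require Import all_boot all_order all_algebra.
From mathcomp Require Import all_classical all_reals all_analysis.
From mathcomp Require Import complex ring lra.

Set Implicit Arguments.
Unset Strict Implicit.
Unset Printing Implicit Defensive.

Import Order.TTheory GRing.Theory Num.Theory.
Import numFieldNormedType.Exports.

Local Open Scope classical_set_scope.
Local Open Scope complex_scope.
Local Open Scope ring_scope.

(** Let [p_i] and [q_i] be the values of the linear forms [p] and [q] on column
    [i], let [P = p_alpha], [Q = q_beta], [S = p_beta], [T = q_alpha],
    [a = (q, q)], [b = (p, q)], and let [d] be 1 or 0 according as [alpha] and
    [beta] are equal or not.

    The Laplacian is the sum of the second derivatives along an orthonormal
    frame of left-invariant fields ([laplacianE]), because the bracket term of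
    the connection is trace free. Summing over the matrices
    [(E_rs - E_sr) / sqrt 2] gives [tau p_i = - (n - 1) / 2 * p_i] and
    [2 <grad p_i, grad q_j> = delta_ij (p, q) - p_j q_i]
    ([frame_sum_colform], [kappa_colform]). The rules for products and inverses
    then yield [tau f = (S T - d b) / Q^2 - P / Q + a P / Q^3]
    ([tau_quotient]) and, applied once more, [tau (tau f)]
    ([tau_tau_quotient]). The second step differentiates the first formula, so
    the formula has to hold around the point. It does hold at every matrix [y]
    with [Q y <> 0] if [a] and [b] stand for [q y y^T q^T] and [q y y^T p^T]:
    these functions are annihilated by left-invariant fields, and they are the
    constants [(q, q)] and [(p, q)] on SO(n).

    If [alpha = beta], then [tau f = (a P - b Q) / Q^3] and
    [tau (tau f) = (a P - b Q) ((n - 4) Q^2 + 6 a) / Q^5]. The column is an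
    arbitrary unit vector [v] ([SO_column]), and a product of polynomial
    functions vanishes on real vectors only if one factor does
    ([linform_mul_eq0]). Since [p] and [q] are independent, [a P - b Q] vanishes
    only for [a = b = 0]; the form [(n - 4) Q^2 + 6 a |v|^2] vanishes only for
    [n = 4] and [a = 0] ([quadric_eq0]).

    If [alpha <> beta], the two columns form an arbitrary orthonormal pair
    [(u, v)] ([SO_columns]), and either condition reads
    [A(v) p(u) + B(v) q(u) = 0]. By [pencil_eq0] this forces [A] and [B] to
    vanish identically. For [tau f] this is impossible, since then
    [A = a - q(v)^2]; for [tau (tau f)] it means [a = b = 0], and then the formula
    for [tau (tau f)] does vanish. *)

(** * The derivative of the matrix exponential along a line *)

Lemma cvg_mx (R : realType) m n (u : nat -> 'M[R]_(m, n)) (l : 'M[R]_(m, n)) :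
  (forall i j, (fun k => u k i j) @ \oo --> l i j) -> u @ \oo --> l.
Proof.
move=> h; apply/cvgrPdist_le => e e0; near=> k.
rewrite /Num.Def.normr/= mx_normrE (bigmax_le _ (ltW e0))//= => i _.
rewrite !mxE; move: i; near: k; apply: filter_forall => /= i.
exact: ((cvgrPdist_le _ _).1 (h i.1 i.2)).
Unshelve. all: by end_near. Qed.

Lemma limn_pseries0 (R : realType) (c : nat -> R) : limn (pseries c 0) = c 0%N.
Proof.
apply: cvg_lim => //; apply: cvg_near_cst; near=> N.
rewrite /pseries /series /=.
have -> : N = N.-1.+1 by rewrite prednK//; near: N; exists 1%N.
rewrite big_nat_recl// big1_seq ?addr0; last first.
  by move=> k _; rewrite exprS mul0r mulr0.
by rewrite expr0 mulr1.
Unshelve. all: by end_near. Qed.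

Section MatrixExponential.
Variables (R : realType) (n : nat).
Implicit Types (X : 'M[R]_n) (s : R).

Let mxsum X : R := \sum_i \sum_j `|X i j|.

Let mxsum_ge0 X : 0 <= mxsum X.
Proof. by apply: sumr_ge0 => i _; apply: sumr_ge0. Qed.

Lemma normr_exprmx X k i j : `|(X ^+ k) i j| <= mxsum X ^+ k.
Proof.
elim: k i j => [|k IH] i j.
  by rewrite !expr0 mxE normr_nat lern1 leq_b1.
rewrite exprS mxE (le_trans (ler_norm_sum _ _ _))// exprS.
apply: (@le_trans _ _ ((\sum_l `|X i l|) * mxsum X ^+ k)).
  by rewrite mulr_suml ler_sum// => l _; rewrite normrM ler_wpM2l.
rewrite ler_wpM2r ?exprn_ge0// /mxsum [leRHS](bigD1 i)//= lerDl.
by apply: sumr_ge0 => ? _; apply: sumr_ge0.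
Qed.

Lemma exprmxZ s X k : (s *: X) ^+ k = s ^+ k *: X ^+ k.
Proof.
elim: k => [|k IH]; first by rewrite !expr0 scale1r.
by rewrite !exprS IH -[LHS]/(_ *m _) -scalemxAl -scalemxAr scalerA.
Qed.

Lemma is_cvg_pseries_exp_bound (c : nat -> R) (C M K : R) : 0 <= C -> 0 <= M ->
  (forall k, `|c k| <= C * (k`!%:R^-1 * M ^+ k)) -> cvgn (pseries c K).
Proof.
move=> C0 M0 h; apply: normed_cvg; rewrite /pseries /=.
apply: (@series_le_cvg _ _ (fun k => C * exp_coeff (M * `|K|) k)).
- by move=> k /=.
- by move=> k; rewrite mulr_ge0// exp_coeff_ge0// mulr_ge0.
- move=> k /=; rewrite normrM normrX /exp_coeff /= exprMn.
  have := ler_wpM2r (exprn_ge0 k (normr_ge0 K)) (h k).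
  by move/le_trans; apply; rewrite le_eqVlt; apply/orP; left; apply/eqP; ring.
- rewrite (_ : (fun k => _) = C *: exp_coeff (M * `|K|)) //.
  by apply: is_cvg_seriesZ; exact: is_cvg_series_exp_coeff.
Qed.

(** The shift by [m] covers the [m]-th termwise derivative of the power series
    of an entry of the exponential. *)
Let is_cvg_expmx_shift X i j m K :
  cvgn (pseries (fun k => k`!%:R^-1 * (X ^+ (k + m)) i j) K).
Proof.
apply: (@is_cvg_pseries_exp_bound _ (mxsum X ^+ m) (mxsum X)) => // [|k].
  exact: exprn_ge0.
rewrite normrM ger0_norm// mulrCA ler_wpM2l// mulrC -exprD.
by rewrite normr_exprmx.
Qed.

Let diffs_expmx X i j m :
  pseries_diffs (fun k => k`!%:R^-1 * (X ^+ (k + m)) i j) =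
  (fun k => k`!%:R^-1 * (X ^+ (k + m.+1)) i j).
Proof.
apply/funext => k; rewrite /pseries_diffs factS natrM invfM mulrA.
by rewrite mulrA divff ?pnatr_eq0// mul1r addSnnS.
Qed.

Lemma expmxE X s i j :
  expmx (s *: X) i j =
  limn (pseries (fun k => k`!%:R^-1 * (X ^+ (k + 0)) i j) s).
Proof.
pose L := \matrix_(i, j)
  limn (pseries (fun k => k`!%:R^-1 * (X ^+ (k + 0)) i j) s).
suff : series (fun k => k`!%:R^-1 *: (s *: X) ^+ k) @ \oo --> L.
  by move/cvg_lim => limE; rewrite /expmx limE // mxE.
apply: cvg_mx => a b; rewrite mxE.
rewrite (_ : (fun k => _) =
    pseries (fun k => k`!%:R^-1 * (X ^+ (k + 0)) a b) s).
  exact: is_cvg_expmx_shift.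
apply/funext => N; rewrite /pseries /series /= summxE; apply: eq_bigr => k _.
by rewrite addn0 exprmxZ !mxE; ring.
Qed.

Lemma is_derive_expmx X i j :
  is_derive (0 : R) 1 (fun s => expmx (s *: X) i j) (X i j).
Proof.
rewrite (_ : (fun s => _) = (fun s => limn
  (pseries (fun k => k`!%:R^-1 * (X ^+ (k + 0)) i j) s))); last first.
  by apply/funext => s; rewrite expmxE.
have h := @pseries_snd_diffs R (fun k => k`!%:R^-1 * (X ^+ (k + 0)) i j) 1 0.
rewrite !diffs_expmx normr0 normr1 ltr01 in h.
have {h} := h (@is_cvg_expmx_shift X i j 0 1) (@is_cvg_expmx_shift X i j 1 1)
  (@is_cvg_expmx_shift X i j 2 1) isT.
by rewrite limn_pseries0 fact0 invr1 mul1r add0n expr1.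
Qed.

Lemma expmx0 : expmx (0 : 'M[R]_n) = 1%:M.
Proof.
apply/matrixP => i j; rewrite -[X in expmx X](scale0r 0) expmxE.
by rewrite limn_pseries0 fact0 invr1 mul1r addn0 expr0.
Qed.

End MatrixExponential.

(** * The Laplacian as a sum over an orthonormal frame *)

Lemma is_derive_bigsum (R : realType) (I : Type) (r : seq I) (P : pred I)
    (h : I -> R -> R) (dh : I -> R) (x v : R) :
  (forall i, is_derive x v (h i) (dh i)) ->
  is_derive x v (fun t => \sum_(i <- r | P i) h i t) (\sum_(i <- r | P i) dh i).
Proof.
move=> hd; rewrite (_ : (fun t => _) = \sum_(i <- r | P i) h i); last first.
  by apply/funext => t; rewrite fct_sumE.
apply: (big_rec2 (fun f l => is_derive x v f l)) => [|i l f _ IH].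
  exact: is_derive_cst.
exact: is_deriveD.
Qed.

Section Laplacian.
Variables (R : realType) (n : nat).
Implicit Types (X Y : 'M[R]_n).

Lemma metric_suml (I : Type) (r : seq I) (P : pred I) (F : I -> 'M[R]_n) X :
  metric (\sum_(i <- r | P i) F i) X = \sum_(i <- r | P i) metric (F i) X.
Proof. by rewrite /metric mulmx_suml raddf_sum. Qed.

Lemma so_lin a X Y : so X -> so Y -> so (a *: X + Y).
Proof.
rewrite /so /= => hX hY.
by rewrite linearD linearZ /= hX hY scalerN opprD.
Qed.

Lemma so_sum (I : Type) (r : seq I) (P : pred I) (F : I -> 'M[R]_n) :
  (forall i, so (F i)) -> so (\sum_(i <- r | P i) F i).
Proof.
move=> h; elim/big_ind : _ => [|X Y hX hY|i _]; last exact: h.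
  by rewrite /so /= trmx0 oppr0.
by rewrite -[X]scale1r; exact: so_lin.
Qed.

Lemma soZ a X : so X -> so (a *: X).
Proof. by rewrite /so /= => hX; rewrite linearZ /= hX scalerN. Qed.

Lemma metric_delta r s X : metric (delta_mx r s) X = X r s.
Proof.
rewrite metricE (bigD1 r)//= [X in _ + X]big1 ?addr0 => [|i /negbTE ir].
  rewrite (bigD1 s)//= big1 ?addr0 => [|j /negbTE js].
    by rewrite mxE !eqxx mul1r.
  by rewrite mxE js andbF mul0r.
by rewrite big1// => j _; rewrite mxE ir mul0r.
Qed.

Lemma so_expand X : so X ->
  X = \sum_(r < n) \sum_(s < n | (r < s)%N)
        metric X (so_frame R r s) *: so_frame R r s.
Proof.
move=> hX; have skew i j : X j i = - X i j.
  by move: hX; rewrite /so /= => /matrixP/(_ i j); rewrite !mxE.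
have diag i : X i i = 0 by have := skew i i; lra.
have E r s : metric X (so_frame R r s) *: so_frame R r s =
    X r s *: delta_mx r s + X s r *: delta_mx s r.
  have -> : metric X (so_frame R r s) = (Num.sqrt 2)^-1 * (X r s - X s r).
    rewrite metricC /so_frame metricZl metricDl -(scaleN1r (delta_mx s r)).
    by rewrite metricZl !metric_delta mulN1r.
  rewrite /so_frame scalerA mulrAC -expr2 exprVn sqr_sqrtr ?ler0n//.
  rewrite scalerBr (skew r s) -scaleNr; congr (_ *: _ + _ *: _); lra.
rewrite {1}(matrix_sum_delta X).
under [RHS]eq_bigr => r _ do under eq_bigr => s _ do rewrite E.
under [RHS]eq_bigr => r _ do rewrite big_split /=.
rewrite big_split /= [X in _ + X](exchange_big_dep predT) //= -big_split /=.
apply: eq_bigr => r _; rewrite (bigID (fun s : 'I_n => (r < s)%N)) /=.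
congr (_ + _); rewrite (bigID (fun s : 'I_n => s == r)) /= big1 ?add0r;
  last first.
  by move=> i /andP[_ /eqP ->]; rewrite diag scale0r.
by apply: eq_bigl => s; rewrite -leqNgt ltn_neqAle andbC.
Qed.

(** The endomorphism [bracket X] is skew for the metric; this removes the
    bracket term of the Levi-Civita connection from the divergence. *)
Lemma metric_bracket_self X Y : so X -> metric (bracket X Y) X = 0.
Proof.
rewrite /so /= /metric /bracket => ->.
rewrite !mulmxN linearN /= mulmxBl linearB /=.
by rewrite -mulmxA mxtrace_mulC subrr oppr0.
Qed.

(** The weak form of openness that derivatives along the curves
    [s |-> y exp (s X)] see: a formula that holds on such a set of matrices
    can be differentiated along these curves at each of its points. *)
Definition flow_open (U : set 'M[R]_n) : Prop := forall y X, U y -> so X ->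
  \forall s \near (0 : R), U (y *m expmx (s *: X)).

(** A linear functional on so(n) is represented by exactly one vector, whose
    coordinates in the orthonormal frame are the values on the frame. *)
Lemma gradE (u : 'M[R]_n -> R) y (D : 'M[R]_n -> R) :
  (forall a X Y, D (a *: X + Y) = a * D X + D Y) ->
  (forall X, so X ->
     is_derive (0 : R) 1 (fun s => u (y *m expmx (s *: X))) (D X)) ->
  grad u y = \sum_(r < n) \sum_(s < n | (r < s)%N)
        D (so_frame R r s) *: so_frame R r s.
Proof.
move=> Dlin hD; set G := \sum_(r < n) _.
have D0 : D 0 = 0 by have := Dlin (-1) 0 0; rewrite scaler0 add0r mulN1r addNr.
have Dsum (I : Type) (r : seq I) P (F : I -> R) (E : I -> 'M[R]_n) :
    D (\sum_(i <- r | P i) F i *: E i) = \sum_(i <- r | P i) F i * D (E i).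
  apply: (big_rec2 (fun a b => D a = b)) => // i b a _ <-.
  by rewrite Dlin.
have DsumD (I : Type) (r : seq I) P (E : I -> 'M[R]_n) :
    D (\sum_(i <- r | P i) E i) = \sum_(i <- r | P i) D (E i).
  have := @Dsum I r P (fun=> 1) E; under eq_bigr do rewrite scale1r.
  by move=> ->; apply: eq_bigr => i _; rewrite mul1r.
have soG : so G.
  by apply: so_sum => r; apply: so_sum => s; apply/soZ/so_frame_so.
have derE X : so X -> lderive u y X = D X.
  by move=> hX; rewrite /lderive derive1E; have [_ ->] := hD X hX.
have GX X : so X -> metric G X = D X.
  move=> hX; rewrite [in RHS](so_expand hX) DsumD metric_suml.
  apply: eq_bigr => r _; rewrite Dsum metric_suml.
  by apply: eq_bigr => s _; rewrite metricZl metricC mulrC.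
have : (grad u y) \in [set G : 'M[R]_n |
        so G /\ forall X, so X -> metric G X = lderive u y X].
  by rewrite inE; apply: (@getPex _ _); exists G; split => // X hX;
    exact: etrans (GX X hX) (esym (derE X hX)).
rewrite inE => -[sog hg]; apply/eqP; rewrite -subr_eq0; apply/eqP/metric_eq0.
have soB : so (grad u y - G) by rewrite -scaleN1r addrC; apply: so_lin.
have BE H : metric (grad u y - G) H = metric (grad u y) H - metric G H.
  by rewrite metricDl -(scaleN1r G) metricZl mulN1r.
by rewrite BE (hg _ soB) (derE _ soB) (GX _ soB) subrr.
Qed.

(** Differentiating the coordinates of the gradient gives the second
    derivatives; the bracket term of the connection contributes nothing, so the
    divergence of the gradient is the trace of [D2] over the frame. *)
Lemma laplacianE (U : set 'M[R]_n) (u : 'M[R]_n -> R)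
    (D : 'M[R]_n -> 'M[R]_n -> R) (D2 : 'M[R]_n -> 'M[R]_n -> 'M[R]_n -> R) :
  flow_open U ->
  (forall y a X Y, U y -> D y (a *: X + Y) = a * D y X + D y Y) ->
  (forall y X, U y -> so X ->
     is_derive (0 : R) 1 (fun s => u (y *m expmx (s *: X))) (D y X)) ->
  (forall y X Y, U y -> so X -> so Y ->
     is_derive (0 : R) 1 (fun s => D (y *m expmx (s *: X)) Y) (D2 y X Y)) ->
  forall y, U y -> laplacian u y =
    \sum_(r < n) \sum_(s < n | (r < s)%N) D2 y (so_frame R r s) (so_frame R r s).
Proof.
move=> openU Dlin hD hD2 y Uy; rewrite /laplacian /divergence.
apply: eq_bigr => r _; apply: eq_bigr => s rs.
set e := so_frame R r s; have soe : so e := so_frame_so R r s.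
rewrite /covariant metricDl metricZl metric_bracket_self // mulr0 addr0.
have -> : lderive (grad u) y e = \sum_(r < n) \sum_(s < n | (r < s)%N)
    D2 y e (so_frame R r s) *: so_frame R r s.
  pose G t : 'M[R]_n := \sum_(r < n) \sum_(s < n | (r < s)%N)
    D (y *m expmx (t *: e)) (so_frame R r s) *: so_frame R r s.
  have nearG : {near (0 : R), grad u \o (fun t => y *m expmx (t *: e)) =1 G}.
    near=> t; rewrite /= /G; apply: gradE.
      by move=> a X Y; apply: Dlin; near: t; exact: openU.
    by move=> X hX; apply: hD => //; near: t; exact: openU.
  rewrite /lderive derive1E (near_eq_derive _ nearG).
  have dG i j : is_derive (0 : R) 1 (fun t => G t i j)
    ((\sum_(r < n) \sum_(s < n | (r < s)%N)
        D2 y e (so_frame R r s) *: so_frame R r s) i j).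
    have scalemxE (a : R) (M : 'M[R]_n) : (a *: M) i j = a * M i j.
      by rewrite mxE.
    have summxE2 (F : 'I_n -> 'I_n -> 'M[R]_n) :
        (\sum_(r < n) \sum_(s < n | (r < s)%N) F r s) i j =
        \sum_(r < n) \sum_(s < n | (r < s)%N) F r s i j.
      by rewrite summxE; apply: eq_bigr => k _; rewrite summxE.
    rewrite summxE2 (_ : (fun t => _) = (fun t => \sum_(r < n)
        \sum_(s < n | (r < s)%N)
          (D (y *m expmx (t *: e)) (so_frame R r s) *: so_frame R r s) i j));
      last by apply/funext => t; rewrite /G summxE2.
    apply: is_derive_bigsum => r'; apply: is_derive_bigsum => s'.
    move: (so_frame R r' s') (so_frame_so R r' s') => w sow.
    rewrite (_ : (fun t => _) = w i j \*: (fun t => D (y *m expmx (t *: e)) w)).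
      by rewrite scalemxE mulrC; apply: is_deriveZ; apply: hD2.
    by apply/funext => t; rewrite scalemxE mulrC.
  rewrite derive_mx; last by apply/derivable_mxP => i j; have [] := dG i j.
  by apply/matrixP => i j; rewrite mxE; have [_ ->] := dG i j.

rewrite metric_suml (bigD1 r)//= [X in _ + X]big1 ?addr0 => [|r' rr'];
  last first.
  rewrite metric_suml big1// => s' rs'.
  by rewrite metricZl metric_so_frame// (negbTE rr') mulr0.
rewrite metric_suml (bigD1 s)//= [X in _ + X]big1 ?addr0 =>
  [|s' /andP[rs' ss']]; last first.
  by rewrite metricZl metric_so_frame// (negbTE ss') andbF mulr0.
by rewrite metricZl metric_so_frame// !eqxx mulr1.
Unshelve. all: by end_near. Qed.

End Laplacian.

(** * Derivatives of complex-valued curves *)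

Section ComplexDerivative.
Variable R : realType.
Implicit Types (c d : R -> R[i]) (l m : R[i]).

Definition cderiv c l : Prop :=
  is_derive (0 : R) 1 (fun s => complex.Re (c s)) (complex.Re l) /\
  is_derive (0 : R) 1 (fun s => complex.Im (c s)) (complex.Im l).

Lemma cderiv_near c d l : (\forall s \near (0 : R), c s = d s) ->
  cderiv c l -> cderiv d l.
Proof.
move=> cd [h1 h2]; split.
  by apply: near_eq_is_derive h1; near do congr complex.Re.
by apply: near_eq_is_derive h2; near do congr complex.Im.
Unshelve. all: by end_near. Qed.

Lemma cderiv_cst l : cderiv (fun=> l) 0.
Proof. by split; exact: is_derive_cst. Qed.

Lemma cderiv_real (g : R -> R) t :
  is_derive (0 : R) 1 g t -> cderiv (fun s => (g s)%:C) t%:C.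
Proof. by move=> h; split => //; exact: is_derive_cst. Qed.

Lemma cderivD c d l m : cderiv c l -> cderiv d m ->
  cderiv (fun s => c s + d s) (l + m).
Proof.
move=> [c1 c2] [d1 d2]; split; rewrite raddfD /=.
  rewrite (_ : (fun s => _) =
    (fun s => complex.Re (c s)) + (fun s => complex.Re (d s))).
    exact: is_deriveD.
  by apply/funext => s /=; rewrite raddfD.
rewrite (_ : (fun s => _) =
  (fun s => complex.Im (c s)) + (fun s => complex.Im (d s))).
  exact: is_deriveD.
by apply/funext => s /=; rewrite raddfD.
Qed.

Lemma complexImD (x y : R[i]) :
  complex.Im (x + y) = complex.Im x + complex.Im y.
Proof. by case: x y => [a b] [a' b']. Qed.

Lemma complexReD (x y : R[i]) :
  complex.Re (x + y) = complex.Re x + complex.Re y.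
Proof. by case: x y => [a b] [a' b']. Qed.

Lemma complexRe_sum (I : Type) (r : seq I) (P : pred I) (F : I -> R[i]) :
  complex.Re (\sum_(i <- r | P i) F i) = \sum_(i <- r | P i) complex.Re (F i).
Proof.
by rewrite (big_morph (@complex.Re R) complexReD (erefl : complex.Re 0 = 0)).
Qed.

Lemma complexIm_sum (I : Type) (r : seq I) (P : pred I) (F : I -> R[i]) :
  complex.Im (\sum_(i <- r | P i) F i) = \sum_(i <- r | P i) complex.Im (F i).
Proof.
by rewrite (big_morph (@complex.Im R) complexImD (erefl : complex.Im 0 = 0)).
Qed.

Lemma complexReM (x y : R[i]) : complex.Re (x * y) =
  complex.Re x * complex.Re y - complex.Im x * complex.Im y.
Proof. by case: x y => [a b] [a' b']. Qed.

Lemma complexImM (x y : R[i]) : complex.Im (x * y) =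
  complex.Re x * complex.Im y + complex.Im x * complex.Re y.
Proof. by case: x y => [a b] [a' b']. Qed.

Lemma cderivM c d l m : cderiv c l -> cderiv d m ->
  cderiv (fun s => c s * d s) (l * d 0 + c 0 * m).
Proof.
move=> [c1 c2] [d1 d2]; split; rewrite raddfD /=.
  rewrite (_ : (fun s => _) =
     (fun s => complex.Re (c s)) * (fun s => complex.Re (d s)) -
     (fun s => complex.Im (c s)) * (fun s => complex.Im (d s))).
    by apply: is_derive_eq (is_deriveB (is_deriveM c1 d1) (is_deriveM c2 d2)) _;
      rewrite !(complexReM, complexImM) /GRing.scale /=; ring.
  by apply/funext => s /=; rewrite complexReM.
rewrite (_ : (fun s => _) =
     (fun s => complex.Re (c s)) * (fun s => complex.Im (d s)) +
     (fun s => complex.Im (c s)) * (fun s => complex.Re (d s))).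
  by apply: is_derive_eq (is_deriveD (is_deriveM c1 d2) (is_deriveM c2 d1)) _;
    rewrite !(complexReM, complexImM) /GRing.scale /=; ring.
by apply/funext => s /=; rewrite complexImM.
Qed.

Lemma cderiv_conj c l : cderiv c l -> cderiv (fun s => (c s)^*) l^*.
Proof.
move=> [h1 h2]; split.
  rewrite (_ : complex.Re l^* = complex.Re l); last by case: l {h1 h2}.
  rewrite (_ : (fun s => _) = fun s => complex.Re (c s))//.
  by apply/funext => s; case: (c s).
rewrite (_ : complex.Im l^* = - complex.Im l); last by case: l {h1 h2}.
rewrite (_ : (fun s => _) = - fun s => complex.Im (c s)).
  exact: is_deriveN.
apply/funext => s; change (complex.Im (c s)^* = - complex.Im (c s)).
by case: (c s).
Qed.

(** Writing [1 / c] as the conjugate of [c] divided by the real number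
    [c * c^*] reduces the rule to the inverse of a real function. *)
Lemma cderivV c l : c 0 != 0 -> cderiv c l ->
  cderiv (fun s => (c s)^-1) (- l / c 0 ^+ 2).
Proof.
move=> c0 hc; pose N s := c s * (c s)^*.
have [hN _] := cderivM hc (cderiv_conj hc).
have NE s : (complex.Re (N s))%:C = N s.
  apply/eqP; rewrite /N eq_complex eqxx complexImM; case: (c s) => a b /=.
  by apply/eqP; ring.
have N0 : complex.Re (N 0) != 0.
  by rewrite -(inj_eq (@complexI R)) NE mulf_eq0 negb_or conjc_eq0 c0.
have h := cderivM (cderiv_conj hc) (cderiv_real (is_deriveV N0 hN)).
rewrite (_ : (fun s => _) =
    fun s => (c s)^* * ((complex.Re (N s))^-1)%:C); last first.
  apply/funext => s; rewrite fmorphV /= NE /N.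
  have [->|cs0] := eqVneq (c s) 0; first by rewrite mul0r invr0 mulr0.
  by rewrite invfM mulrCA divff ?mulr1 // conjc_eq0.
rewrite (_ : - l / _ = (l^* * ((complex.Re (N 0))^-1)%:C + (c 0)^* *
  (- complex.Re (N 0) ^- 2 *: complex.Re (l * (c 0)^* + c 0 * l^*))%:C)) //.
rewrite [in RHS]/GRing.scale /= rmorphM rmorphN !fmorphV rmorphXn /= NE /N.
have -> : (complex.Re (l * (c 0)^* + c 0 * l^*))%:C = l * (c 0)^* + c 0 * l^*.
  apply/eqP; rewrite eq_complex eqxx /= complexImD !complexImM.
  by case: (c 0) l {hc hN h} => a b [a' b'] /=; apply/eqP; ring.
by field; rewrite conjc_eq0 c0.
Qed.

Lemma cderiv_near_neq0 c l : cderiv c l -> c 0 != 0 ->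
  \forall s \near (0 : R), c s != 0.
Proof.
move=> [[h1 _] [h2 _]] c0.
have C1 : {for (0 : R), continuous (fun s => complex.Re (c s))}.
  by apply: differentiable_continuous; apply/derivable1_diffP; exact: h1.
have C2 : {for (0 : R), continuous (fun s => complex.Im (c s))}.
  by apply: differentiable_continuous; apply/derivable1_diffP; exact: h2.
have [Re0|Re0] := eqVneq (complex.Re (c 0)) 0; last first.
  by apply: filterS (cvgr_neq0 _ C1 Re0) => s; apply: contraNN => /eqP ->.
have Im0 : complex.Im (c 0) != 0 by move: c0; rewrite eq_complex Re0 eqxx.
by apply: filterS (cvgr_neq0 _ C2 Im0) => s; apply: contraNN => /eqP ->.
Qed.

End ComplexDerivative.

(** * Second-order calculus along left-invariant fields *)

Section Jets.
Variables (R : realType) (n : nat).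
Notation C := (R[i]).
Notation M := ('M[R]_n).
Implicit Types (f g : M -> C) (y X Y : M) (U : set M) (D E : M -> M -> C).

Definition lder f y X (l : C) : Prop :=
  cderiv (fun s => f (y *m expmx (s *: X))) l.

Lemma expmx_start y X : y *m expmx ((0 : R) *: X) = y.
Proof. by rewrite scale0r expmx0 mulmx1. Qed.

Lemma lder_eq f y X (l l' : C) : lder f y X l -> l = l' -> lder f y X l'.
Proof. by move=> + <-. Qed.

Lemma lderD f g y X (l m : C) : lder f y X l -> lder g y X m ->
  lder (fun z => f z + g z) y X (l + m).
Proof. exact: cderivD. Qed.

Lemma lderM f g y X (l m : C) : lder f y X l -> lder g y X m ->
  lder (fun z => f z * g z) y X (l * g y + f y * m).
Proof.
have rule (c : R -> M) : c 0 = y -> cderiv (f \o c) l -> cderiv (g \o c) m ->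
    cderiv (fun s => f (c s) * g (c s)) (l * g y + f y * m).
  by move=> <-; exact: cderivM.
exact: (rule (fun s => y *m expmx (s *: X)) (expmx_start y X)).
Qed.

Lemma lderV f y X (l : C) : f y != 0 -> lder f y X l ->
  lder (fun z => (f z)^-1) y X (- l / f y ^+ 2).
Proof.
have rule (c : R -> M) : c 0 = y -> f y != 0 -> cderiv (f \o c) l ->
    cderiv (fun s => (f (c s))^-1) (- l / f y ^+ 2).
  by move=> <-; exact: cderivV.
exact: (rule (fun s => y *m expmx (s *: X)) (expmx_start y X)).
Qed.

Lemma lder_cst (c : C) y X : lder (fun=> c) y X 0.
Proof. exact: cderiv_cst. Qed.

Lemma lder_entry (i j : 'I_n) y X :
  lder (fun z => (z i j)%:C) y X ((y *m X) i j)%:C.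
Proof.
apply: cderiv_real; rewrite mxE (_ : (fun s => _) = fun s : R =>
   \sum_k (y i k \*: (fun s => expmx (s *: X) k j)) s); last first.
  by apply/funext => s; rewrite mxE.
by apply: is_derive_bigsum => k; apply: is_deriveZ; exact: is_derive_expmx.
Qed.

Definition frame_sum (G : M -> C) : C :=
  \sum_(r < n) \sum_(s < n | (r < s)%N) G (so_frame R r s).

Lemma frame_sum0 : frame_sum (fun=> 0) = 0.
Proof. by rewrite /frame_sum big1// => r _; rewrite big1. Qed.

Lemma frame_sumD (G H : M -> C) :
  frame_sum (fun e => G e + H e) = frame_sum G + frame_sum H.
Proof.
by rewrite /frame_sum -big_split; apply: eq_bigr => r _; rewrite big_split.
Qed.

Lemma frame_sumZ (c : C) (G : M -> C) :
  frame_sum (fun e => c * G e) = c * frame_sum G.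
Proof.
by rewrite /frame_sum mulr_sumr; apply: eq_bigr => r _; rewrite mulr_sumr.
Qed.

Lemma eq_frame_sum (G H : M -> C) : (forall X, so X -> G X = H X) ->
  frame_sum G = frame_sum H.
Proof.
move=> GH; apply: eq_bigr => r _; apply: eq_bigr => s _; apply: GH.
exact: so_frame_so.
Qed.

(** [D] is the differential in the left trivialization and [D2 y X Y] is the
    derivative of [D _ Y] along [X]; linearity of [D] makes it the differential
    that the gradient represents. *)
Definition jet U f D (D2 : M -> M -> M -> C) : Prop :=
  [/\ forall y X, U y -> so X -> lder f y X (D y X),
      forall y a X Y, U y -> D y (a *: X + Y) = a%:C * D y X + D y Y
    & forall y X Y, U y -> so X -> so Y ->
        lder (fun z => D z Y) y X (D2 y X Y)].

Lemma tau_jet U f D (D2 : M -> M -> M -> C) y :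
  flow_open U -> jet U f D D2 -> U y ->
  tau f y = frame_sum (fun e => D2 y e e).
Proof.
move=> openU [hD Dlin hD2] Uy; rewrite /tau.
have -> : laplacian (fun z => complex.Re (f z)) y = \sum_(r < n)
    \sum_(s < n | (r < s)%N) complex.Re (D2 y (so_frame R r s) (so_frame R r s)).
  apply: (@laplacianE _ _ U _ (fun y X => complex.Re (D y X))
    (fun y X Y => complex.Re (D2 y X Y))) => //.
  - by move=> z a X Y Uz; rewrite Dlin// complexReD complexReM /=; ring.
  - by move=> z X Uz hX; have [] := hD z X Uz hX.
  - by move=> z X Y Uz hX hY; have [] := hD2 z X Y Uz hX hY.
have -> : laplacian (fun z => complex.Im (f z)) y = \sum_(r < n)
    \sum_(s < n | (r < s)%N) complex.Im (D2 y (so_frame R r s) (so_frame R r s)).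
  apply: (@laplacianE _ _ U _ (fun y X => complex.Im (D y X))
    (fun y X Y => complex.Im (D2 y X Y))) => //.
  - by move=> z a X Y Uz; rewrite Dlin// complexImD complexImM /=; ring.
  - by move=> z X Uz hX; have [_] := hD z X Uz hX.
  - by move=> z X Y Uz hX hY; have [_] := hD2 z X Y Uz hX hY.
rewrite /frame_sum.
apply/eqP; rewrite eq_complex /=; apply/andP; split; apply/eqP.
  by rewrite complexRe_sum; apply: eq_bigr => r _; rewrite complexRe_sum.
by rewrite complexIm_sum; apply: eq_bigr => r _; rewrite complexIm_sum.
Qed.

(** [L] is the Laplacian of [f]. The second derivative itself can be forgotten,
    because the rules for products and inverses only involve its trace and the
    pairing [kappa] of differentials. *)
Definition traced_jet U f D (L : M -> C) : Prop :=
  exists D2 : M -> M -> M -> C,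
    jet U f D D2 /\ forall y, U y -> frame_sum (fun e => D2 y e e) = L y.

(** The complex-bilinear scalar product of two gradients. *)
Definition kappa D E y : C := frame_sum (fun e => D y e * E y e).

Lemma traced_jet_eq U f f' D L L' : flow_open U -> traced_jet U f D L ->
  (forall y, U y -> f y = f' y) -> (forall y, U y -> L y = L' y) ->
  traced_jet U f' D L'.
Proof.
move=> openU [D2 [[hD Dlin hD2] hL]] ff LL; exists D2; split; last first.
  by move=> y Uy; rewrite hL// LL.
split => // y X Uy hX; apply: cderiv_near (hD y X Uy hX).
by near=> s; apply: ff; near: s; exact: openU.
Unshelve. all: by end_near. Qed.

(** Functions that are constant along all left-invariant fields, such as the
    entries of [y *m y^T], play the part of constants. *)
Lemma traced_jet_inv U f : (forall y X, U y -> so X -> lder f y X 0) ->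
  traced_jet U f (fun _ _ => 0) (fun=> 0).
Proof.
move=> hf; exists (fun _ _ _ => 0); split; last by move=> *; rewrite frame_sum0.
split => // [y a X Y _|y X Y _ _ _]; first by rewrite mulr0 addr0.
exact: lder_cst.
Qed.

Lemma traced_jetD U f g D E L K : traced_jet U f D L -> traced_jet U g E K ->
  traced_jet U (fun y => f y + g y) (fun y X => D y X + E y X) (fun y => L y + K y).
Proof.
move=> [D2 [[hD Dlin hD2] hL]] [E2 [[hE Elin hE2] hK]].
exists (fun y X Y => D2 y X Y + E2 y X Y); split; last first.
  by move=> y Uy; rewrite frame_sumD hL// hK.
split => [y X Uy hX|y a X Y Uy|y X Y Uy hX hY].
- by apply: lderD; [exact: hD|exact: hE].
- by rewrite Dlin// Elin//; ring.
- by apply: lderD; [exact: hD2|exact: hE2].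
Qed.

(** The two mixed terms of the Leibniz rule for second derivatives have the
    same trace, the scalar product of the gradients. *)
Lemma traced_jetM U f g D E L K : traced_jet U f D L -> traced_jet U g E K ->
  traced_jet U (fun y => f y * g y) (fun y X => D y X * g y + f y * E y X)
    (fun y => L y * g y + 2 * kappa D E y + f y * K y).
Proof.
move=> [D2 [[hD Dlin hD2] hL]] [E2 [[hE Elin hE2] hK]].
exists (fun y X Y => (D2 y X Y * g y + D y Y * E y X)
                   + (D y X * E y Y + f y * E2 y X Y)); split; last first.
  move=> y Uy; rewrite -hL// -hK// /kappa [L in L + _ + _]mulrC -!frame_sumZ.
  by rewrite -!frame_sumD; apply: eq_frame_sum => X _; ring.
split => [y X Uy hX|y a X Y Uy|y X Y Uy hX hY].
- by apply: lderM; [exact: hD|exact: hE].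
- by rewrite Dlin// Elin//; ring.
- by apply: lderD; apply: lderM; [exact: hD2|exact: hE|exact: hD|exact: hE2].
Qed.

Lemma traced_jetV U f D L : (forall y, U y -> f y != 0) -> traced_jet U f D L ->
  traced_jet U (fun y => (f y)^-1) (fun y X => - D y X / f y ^+ 2)
    (fun y => - L y / f y ^+ 2 + 2 * kappa D D y / f y ^+ 3).
Proof.
move=> f0 [D2 [[hD Dlin hD2] hL]].
exists (fun y X Y => - D2 y X Y / f y ^+ 2 + 2 * (D y X * D y Y) / f y ^+ 3).
split; last first.
  move=> y Uy; rewrite -hL// /kappa.
  transitivity ((- (f y ^+ 2)^-1) * frame_sum (fun e => D2 y e e)
      + (2 / f y ^+ 3) * frame_sum (fun e => D y e * D y e)); last by ring.
  by rewrite -!frame_sumZ -!frame_sumD; apply: eq_frame_sum => X _; ring.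
split => [y X Uy hX|y a X Y Uy|y X Y Uy hX hY].
- by apply: lderV; [exact: f0|exact: hD].
- by rewrite Dlin//; ring.
- have hV := lderV (f0 _ Uy) (hD _ _ Uy hX).
  have := lderM (lderM (lder_cst (-1) y X) (hD2 _ _ _ Uy hX hY)) (lderM hV hV).
  move/lder_eq => /(_ (- D2 y X Y / f y ^+ 2 + 2 * (D y X * D y Y) / f y ^+ 3)) h.
  rewrite (_ : (fun z => - D z Y / f z ^+ 2) =
     (fun z => -1 * D z Y * ((f z)^-1 * (f z)^-1))); last first.
    by apply/funext => z; rewrite expr2 invfM mulN1r.
  by apply: h; field; apply: f0.
Qed.

Lemma kappaC D E y : kappa D E y = kappa E D y.
Proof. by apply: eq_frame_sum => X _; rewrite mulrC. Qed.

Lemma kappaDl D D' E y :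
  kappa (fun y X => D y X + D' y X) E y = kappa D E y + kappa D' E y.
Proof. by rewrite /kappa -frame_sumD; apply: eq_frame_sum => X _; ring. Qed.

Lemma kappaZl (c : M -> C) D E y :
  kappa (fun y X => c y * D y X) E y = c y * kappa D E y.
Proof. by rewrite /kappa -frame_sumZ; apply: eq_frame_sum => X _; ring. Qed.

Lemma kappaZr (c : M -> C) D E y :
  kappa (fun y X => D y X * c y) E y = kappa D E y * c y.
Proof. by rewrite mulrC -kappaZl; apply: eq_frame_sum => X _; ring. Qed.

Lemma kappa0l E y : kappa (fun _ _ => 0) E y = 0.
Proof.
by rewrite -[RHS]frame_sum0; apply: eq_frame_sum => X _; rewrite mul0r.
Qed.

End Jets.

(** * Linear forms in a column *)

Section ColumnForms.
Variables (R : realType) (n : nat).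
Notation C := (R[i]).
Notation M := ('M[R]_n).
Implicit Types (p q : 'rV[C]_n) (y X Y : M) (U : set M) (i j : 'I_n).

(** This is [p y y^T q^T], the extension of the constant [bilin p q] from SO(n)
    to all matrices that left-invariant fields annihilate. *)
Definition gram p q y : C := \sum_k colform p k y * colform q k y.

Lemma colform_mulmx p i y X :
  colform p i (y *m X) = \sum_k colform p k y * (X k i)%:C.
Proof.
rewrite /colform; under [RHS]eq_bigr do rewrite mulr_suml.
rewrite exchange_big; apply: eq_bigr => j _; rewrite mxE rmorph_sum mulr_sumr.
by apply: eq_bigr => k _; rewrite rmorphM mulrA.
Qed.

Lemma colform_lin p i a X Y :
  colform p i (a *: X + Y) = a%:C * colform p i X + colform p i Y.
Proof.
rewrite /colform mulr_sumr -big_split; apply: eq_bigr => j _ /=.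
by rewrite !mxE rmorphD rmorphM /=; ring.
Qed.

Lemma colformZ p i a X : colform p i (a *: X) = a%:C * colform p i X.
Proof.
rewrite /colform mulr_sumr; apply: eq_bigr => j _ /=.
by rewrite !mxE rmorphM /=; ring.
Qed.

Lemma lder_sum (I : Type) (r : seq I) (f : I -> M -> C) (l : I -> C) y X :
  (forall a, lder (f a) y X (l a)) ->
  lder (fun z => \sum_(a <- r) f a z) y X (\sum_(a <- r) l a).
Proof.
move=> h; elim: r => [|a r IH].
  rewrite big_nil (_ : (fun z => _) = fun=> 0); first exact: lder_cst.
  by apply/funext => z; rewrite big_nil.
rewrite big_cons (_ : (fun z => _) = fun z => f a z + \sum_(b <- r) f b z).
  exact: lderD.
by apply/funext => z; rewrite big_cons.
Qed.

Lemma lder_colform p i y X : lder (colform p i) y X (colform p i (y *m X)).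
Proof.
apply: lder_sum => j; apply: lder_eq.
  by apply: lderM; [exact: lder_cst|exact: lder_entry].
by rewrite mul0r add0r.
Qed.

Lemma flow_open_colform p i : flow_open [set y : M | colform p i y != 0].
Proof.
move=> y X yU _ /=; apply: (cderiv_near_neq0 (lder_colform p i y X)).
by rewrite expmx_start.
Qed.

(** The matrix [y *m y^T] is constant along [s |-> y exp (s X)] since the
    exponential of a skew matrix is orthogonal; at first order this is the
    cancellation of the two terms of the Leibniz rule by skewness of [X]. *)
Lemma gram_inv p q y X : so X -> lder (gram p q) y X 0.
Proof.
move=> hX; apply: lder_eq.
  by apply: lder_sum => k; apply: lderM; exact: lder_colform.
have skew i j : X j i = - X i j.
  by move: hX; rewrite /so /= => /matrixP/(_ i j); rewrite !mxE.
rewrite big_split /=; under eq_bigr do rewrite colform_mulmx mulr_suml.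
under [X in _ + X]eq_bigr do rewrite colform_mulmx mulr_sumr.
rewrite exchange_big -big_split big1// => k _.
rewrite -big_split big1// => l _ /=; rewrite (skew l k) rmorphN /=; ring.
Qed.

Lemma sum_delta (F : 'I_n -> C) i : \sum_k F k * (k == i)%:R = F i.
Proof.
rewrite (bigD1 i)//= eqxx mulr1 big1 ?addr0// => k /negbTE ->.
by rewrite mulr0.
Qed.

Let skew i j : M := delta_mx i j - delta_mx j i.

Lemma colform_skew p i r s y : colform p i (y *m skew r s) =
  colform p r y * (s == i)%:R - colform p s y * (r == i)%:R.
Proof.
rewrite colform_mulmx -[X in X * _](sum_delta (fun k => colform p k y) r).
rewrite -[X in _ - X * _](sum_delta (fun k => colform p k y) s).
rewrite !mulr_suml -sumrB; apply: eq_bigr => k _.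
rewrite !mxE [i == s]eq_sym [i == r]eq_sym.
by case: (k == r) (k == s) (s == i) (r == i) => [] [] [] [] /=;
  rewrite ?(subr0, sub0r, subrr, rmorphN, rmorph1, rmorph0) /= ?rmorph1; ring.
Qed.

(** A quadratic [G] takes the same value on [skew r s] and [skew s r], so that
    summing over ordered pairs counts every frame vector twice; the scaling of
    the frame by [1 / sqrt 2] accounts for the other factor 2. *)
Lemma frame_sum_skew (G : M -> C) :
  (forall a X, G (a *: X) = (a ^+ 2)%:C * G X) ->
  frame_sum G = 4^-1 * \sum_r \sum_s G (skew r s).
Proof.
move=> hG.
have G0 r : G (skew r r) = 0.
  by rewrite /skew subrr -(scale0r 0) hG expr0n mul0r.
have GC r s : G (skew s r) = G (skew r s).
  by rewrite /skew -opprB -scaleN1r hG sqrrN expr1n mul1r.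
have half : \sum_r \sum_s G (skew r s) =
    2 * \sum_(r < n) \sum_(s < n | (r < s)%N) G (skew r s).
  have split r : \sum_s G (skew r s) =
      \sum_(s < n | (r < s)%N) G (skew r s)
      + \sum_(s < n | (s < r)%N) G (skew r s).
    rewrite (bigID (fun s : 'I_n => (r < s)%N)) /=; congr (_ + _).
    rewrite (bigID (fun s : 'I_n => s == r)) /= big1 ?add0r; last first.
      by move=> i /andP[_ /eqP ->].
    by apply: eq_bigl => s; rewrite -leqNgt ltn_neqAle andbC.
  under eq_bigr do rewrite split.
  rewrite big_split /= [X in _ + X](exchange_big_dep predT) //=.
  under [X in _ + X]eq_bigr do under eq_bigr do rewrite GC.
  by ring.
rewrite half mulrA (_ : 4^-1 * 2 = 2^-1 :> C); last by field.
rewrite /frame_sum mulr_sumr; apply: eq_bigr => r _.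
rewrite mulr_sumr; apply: eq_bigr => s _.
by rewrite /so_frame hG exprVn sqr_sqrtr ?ler0n// fmorphV /= rmorph_nat.
Qed.

(** Right multiplication by [skew r s] exchanges the columns [r] and [s] of [y]
    up to a sign and kills the others, so that the sum over the frame collapses
    to the columns [i] and [j]. *)
Lemma kappa_colform p q i j y :
  kappa (fun y X => colform p i (y *m X)) (fun y X => colform q j (y *m X)) y =
  2^-1 * ((i == j)%:R * gram p q y - colform p j y * colform q i y).
Proof.
rewrite /kappa frame_sum_skew => [|a X]; last first.
  by rewrite -scalemxAr !colformZ rmorphXn /=; ring.
pose P k := colform p k y; pose Q k := colform q k y.
transitivity (4^-1 * (\sum_r \sum_s (P r * Q r * (s == j)%:R) * (s == i)%:R
   - \sum_r \sum_s (P r * Q s * (r == j)%:R) * (s == i)%:R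
   - \sum_s \sum_r (P s * Q r * (s == j)%:R) * (r == i)%:R
   + \sum_s \sum_r (P s * Q s * (r == j)%:R) * (r == i)%:R)).
  congr (_ * _); rewrite [X in _ = _ - X + _]exchange_big /=.
  rewrite [X in _ = _ + X]exchange_big /=.
  rewrite -!sumrB -big_split /=; apply: eq_bigr => r _.
  rewrite -!sumrB -big_split /=; apply: eq_bigr => s _.
  by rewrite !colform_skew -/(P r) -/(P s) -/(Q r) -/(Q s); ring.
under eq_bigr do rewrite sum_delta.
under [X in _ - X - _ + _]eq_bigr do rewrite (sum_delta (fun s => _ * Q s * _)).
under [X in _ - _ - X + _]eq_bigr do rewrite (sum_delta (fun s => _ * Q s * _)).
rewrite !(sum_delta (fun r => P r * Q i)) -!mulr_suml -/(gram p q y).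
by rewrite /P /Q; field.
Qed.

(** The square of [skew r s] is minus the projection onto the two coordinates
    [r] and [s], and every index belongs to [n - 1] pairs. *)
Lemma frame_sum_colform p i y :
  frame_sum (fun e => colform p i (y *m e *m e)) =
  - ((n%:R - 1) / 2) * colform p i y.
Proof.
rewrite frame_sum_skew => [|a X]; last first.
  by rewrite -scalemxAr -scalemxAr -scalemxAl !colformZ rmorphXn /=; ring.
pose P k := colform p k y.
transitivity (4^-1 * \sum_r \sum_s ((P r * (r == i)%:R) * (s == r)%:R -
   P s * (s == i)%:R - (P r * (r == i)%:R) + (P r * (r == i)%:R) * (s == r)%:R)).
  congr (_ * _); apply: eq_bigr => r _; apply: eq_bigr => s _.
  rewrite !colform_skew -/(P r) -/(P s) !eqxx.
  by case: (eqVneq s r) => [->|_] /=; ring.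
have E r : \sum_s ((P r * (r == i)%:R) * (s == r)%:R -
   P s * (s == i)%:R - (P r * (r == i)%:R) + (P r * (r == i)%:R) * (s == r)%:R) =
   (2 - n%:R) * (P r * (r == i)%:R) - P i.
  rewrite big_split /= !sumrB !(sum_delta (fun=> P r * (r == i)%:R)) sum_delta.
  by rewrite sumr_const card_ord -mulr_natl; ring.
under eq_bigr do rewrite E.
rewrite sumrB -mulr_sumr sum_delta sumr_const card_ord -mulr_natl.
by rewrite /P; field.
Qed.

Lemma traced_jet_colform U p i : traced_jet U (colform p i)
  (fun y X => colform p i (y *m X))
  (fun y => - ((n%:R - 1) / 2) * colform p i y).
Proof.
exists (fun y X Y => colform p i (y *m X *m Y)); split; last first.
  by move=> y _; exact: frame_sum_colform.
split => [y X _ _|y a X Y _|y X Y _ _ _]; first exact: lder_colform.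
  by rewrite mulmxDr -scalemxAr colform_lin.
rewrite (_ : (fun z => _) = fun z => \sum_k colform p k z * (Y k i)%:C);
  last first.
  by apply/funext => z; rewrite colform_mulmx.
rewrite colform_mulmx; apply: lder_sum => k; apply: lder_eq.
  by apply: lderM; [exact: lder_colform|exact: lder_cst].
by rewrite mulr0 addr0.
Qed.

End ColumnForms.

(** * The first and second Laplacian of a quotient *)

Section Quotients.
Variables (R : realType) (n : nat).
Notation C := (R[i]).
Notation M := ('M[R]_n).
Variables (q : 'rV[C]_n) (beta : 'I_n).
Implicit Types (f g c L k : M -> C) (y : M).

Let Q : M -> C := colform q beta.
Let U : set M := [set y | Q y != 0].
Let DQ (y X : M) : C := colform q beta (y *m X).
Let N : C := (n%:R - 1) / 2.
Let a : M -> C := gram q q.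

Let openU : flow_open U.
Proof. exact: flow_open_colform. Qed.

(** To divide [f] by [Q] one needs, besides its Laplacian [L], the scalar
    product [k] of the gradients of [f] and [Q]. Such triples are stable under sums,
    products with invariants and division by [Q], which is enough to compute
    the Laplacian of every fraction below. *)
Definition paired_jet f L k : Prop :=
  exists D, traced_jet U f D L /\ forall y, U y -> kappa D DQ y = k y.

Lemma paired_jet_congr f f' L k : paired_jet f L k ->
  (forall y, U y -> f y = f' y) -> paired_jet f' L k.
Proof.
by move=> [D [hD hk]] ff; exists D; split => //; apply: traced_jet_eq hD _ _.
Qed.

Lemma paired_jet_inv c : (forall y X, U y -> so X -> lder c y X 0) ->
  paired_jet c (fun=> 0) (fun=> 0).
Proof.
move=> hc; exists (fun _ _ => 0); split; first exact: traced_jet_inv.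
by move=> y _; rewrite kappa0l.
Qed.

Lemma paired_jetD f g L L' k k' : paired_jet f L k -> paired_jet g L' k' ->
  paired_jet (fun y => f y + g y) (fun y => L y + L' y) (fun y => k y + k' y).
Proof.
move=> [D [hD hk]] [E [hE hk']]; exists (fun y X => D y X + E y X); split.
  exact: traced_jetD.
by move=> y Uy; rewrite kappaDl hk// hk'.
Qed.

Lemma paired_jet_invM c f L k : (forall y X, U y -> so X -> lder c y X 0) ->
  paired_jet f L k ->
  paired_jet (fun y => c y * f y) (fun y => c y * L y) (fun y => c y * k y).
Proof.
move=> hc [D [hD hk]].
exists (fun y X => 0 * f y + c y * D y X); split.
  apply: traced_jet_eq (traced_jetM (traced_jet_inv hc) hD) _ _ => // y Uy.
  by rewrite kappa0l; ring.
by move=> y Uy; rewrite kappaDl kappaZr kappa0l kappaZl hk//; ring.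
Qed.

Lemma paired_jet_div f L k : paired_jet f L k ->
  paired_jet (fun y => f y / Q y)
    (fun y => (L y + N * f y) / Q y - 2 * k y / Q y ^+ 2
              + f y * (a y - Q y ^+ 2) / Q y ^+ 3)
    (fun y => k y / Q y - f y * (a y - Q y ^+ 2) / (2 * Q y ^+ 2)).
Proof.
move=> [D [hD hk]]; have hQ := traced_jet_colform U q beta.
have hV := traced_jetV (fun y (Uy : U y) => Uy) hQ.
have KQ y : kappa DQ DQ y = 2^-1 * (a y - Q y ^+ 2).
  by rewrite kappa_colform eqxx mul1r expr2.
have kV E y : kappa E (fun y X => - DQ y X / Q y ^+ 2) y =
    kappa E DQ y * - (Q y ^+ 2)^-1.
  rewrite kappaC (kappaC E) -(kappaZr (fun z => - (Q z ^+ 2)^-1)).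
  by apply: eq_frame_sum => X _; ring.
exists (fun y X => D y X * (Q y)^-1 + f y * (- DQ y X / Q y ^+ 2)); split.
  apply: traced_jet_eq (traced_jetM hD hV) _ _ => // y Uy; rewrite -/(Q y) -/DQ.
  by rewrite kV hk// KQ /N; field.
move=> y Uy; rewrite kappaDl kappaZr kappaZl hk// kappaC kV KQ.
by field.
Qed.

Lemma tau_paired_jet f L k y : paired_jet f L k -> U y -> tau f y = L y.
Proof.
by move=> [D [[D2 [hj hL]] _]] Uy; rewrite (tau_jet openU hj Uy) hL.
Qed.

Variables (p : 'rV[C]_n) (alpha : 'I_n).
Let P : M -> C := colform p alpha.
Let S : M -> C := colform p beta.
Let T : M -> C := colform q alpha.
Let d : C := (alpha == beta)%:R.
Let b : M -> C := gram p q.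

Lemma paired_jet_num : paired_jet P (fun y => - N * P y)
  (fun y => (d * b y - S y * T y) / 2).
Proof.
exists (fun y X => colform p alpha (y *m X)); split; first exact: traced_jet_colform.
by move=> y _; rewrite kappa_colform mulrC.
Qed.

(** The product [S * T] enters through the scalar product of the gradients of
    [P] and [Q], see [paired_jet_num]; it is [P * Q] when [alpha = beta]. *)
Lemma paired_jet_cross : paired_jet (fun y => S y * T y)
  (fun y => - 2 * N * (S y * T y) + (d * b y - P y * Q y))
  (fun y => ((b y - S y * Q y) * T y + S y * (d * a y - T y * Q y)) / 2).
Proof.
have hS := traced_jet_colform U p beta; have hT := traced_jet_colform U q alpha.
exists (fun y X => colform p beta (y *m X) * T y
                   + S y * colform q alpha (y *m X)).
split.
  apply: traced_jet_eq (traced_jetM hS hT) _ _ => // y _; rewrite kappa_colform.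
  by rewrite -/(P y) -/(Q y) -/(S y) -/(T y) -/(b y) eq_sym -/d -/N; field.
move=> y _; rewrite kappaDl kappaZr kappaZl !kappa_colform eqxx mul1r.
by rewrite -/(Q y) -/(S y) -/(T y) -/(b y) -/(a y) -/d; field.
Qed.

Let f y : C := P y / Q y.

Lemma tau_quotient y : Q y != 0 ->
  tau f y = (S y * T y - d * b y) / Q y ^+ 2 - P y / Q y
            + a y * P y / Q y ^+ 3.
Proof.
move=> Uy; rewrite (tau_paired_jet (paired_jet_div paired_jet_num) Uy).
by field.
Qed.

Lemma tau_tau_quotient y : Q y != 0 ->
  tau (tau f) y =
    - d * b y * (n%:R - 6) / Q y ^+ 2
    - (2 * b y * T y + 2 * d * a y * S y - a y * (n%:R - 8) * P y) / Q y ^+ 3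
    + 6 * a y * (S y * T y - d * b y) / Q y ^+ 4
    + 6 * a y ^+ 2 * P y / Q y ^+ 5.
Proof.
move=> Uy.
have cstI (c : C) z X : U z -> so X -> lder (fun=> c) z X 0.
  by move=> _ _; exact: lder_cst.
have invI (c : C) r s z X : U z -> so X -> lder (fun w => c * gram r s w) z X 0.
  move=> Uz hX; apply: lder_eq.
    by apply: lderM; [exact: lder_cst|exact: gram_inv].
  by rewrite mul0r mulr0 addr0.
(* tau f written as a sum of iterated divisions by Q *)
have h1 := paired_jet_div (paired_jet_div
  (paired_jetD paired_jet_cross (paired_jet_inv (@invI (- d) p q)))).
have h2 := paired_jet_invM (@cstI (-1)) (paired_jet_div paired_jet_num).
have h3 := paired_jet_invM (fun z X _ => @gram_inv R n q q z X)
  (paired_jet_div (paired_jet_div (paired_jet_div paired_jet_num))).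
have h := paired_jetD h1 (paired_jetD h2 h3).
rewrite (tau_paired_jet (paired_jet_congr h (f' := tau f) _) Uy).
  by rewrite /N -/(a y) -/(b y); field.
by move=> z Uz; rewrite tau_quotient// -/(a z) -/(b z); field.
Qed.

End Quotients.

(** * Linear forms and quadrics on real vectors *)

Section RealLocus.
Variables (R : realType) (n : nat).
Notation C := (R[i]).
Notation V := ('cV[R]_n).
Implicit Types (p q r z : 'rV[C]_n) (u v w : V) (G H : V -> C).

Definition dot u v : R := \sum_j u j 0 * v j 0.

Definition linform p v : C := \sum_j p 0 j * (v j 0)%:C.

Definition basis_vec (j : 'I_n) : V := delta_mx j 0.

Lemma real_complex_eq0 (s : R) : ((s%:C : C) == 0) = (s == 0).
Proof. by rewrite -(rmorph0 (real_complex R)) (inj_eq (@complexI R)). Qed.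

Lemma dotC u v : dot u v = dot v u.
Proof. by apply: eq_bigr => j _; rewrite mulrC. Qed.

Lemma dot_linl a u v w : dot (a *: u + v) w = a * dot u w + dot v w.
Proof.
rewrite /dot mulr_sumr -big_split; apply: eq_bigr => j _ /=.
by rewrite !mxE; ring.
Qed.

Lemma dot_linr a u v w : dot w (a *: u + v) = a * dot w u + dot w v.
Proof. by rewrite dotC dot_linl !(dotC _ w). Qed.

Lemma dotZZ a b u v : dot (a *: u) (b *: v) = a * b * dot u v.
Proof.
by rewrite /dot mulr_sumr; apply: eq_bigr => j _ /=; rewrite !mxE; ring.
Qed.

Lemma dotZl a u v : dot (a *: u) v = a * dot u v.
Proof. by rewrite -[v]scale1r dotZZ mulr1 scale1r. Qed.

Lemma dot_eq0 v : dot v v = 0 -> v = 0.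
Proof.
move/eqP; rewrite psumr_eq0 => [/allP h|j _]; last by rewrite -expr2 sqr_ge0.
apply/colP => j; rewrite mxE; have /implyP/(_ isT) := h j (mem_index_enum j).
by rewrite mulf_eq0 orbb => /eqP.
Qed.

Lemma dot_basis (j : 'I_n) v : dot v (basis_vec j) = v j 0.
Proof.
rewrite /dot (bigD1 j)//= big1 ?addr0 => [|i ij]; last first.
  by rewrite !mxE (negbTE ij) mulr0.
by rewrite !mxE !eqxx mulr1.
Qed.

Lemma linform_lin p a u v :
  linform p (a *: u + v) = a%:C * linform p u + linform p v.
Proof.
rewrite /linform mulr_sumr -big_split; apply: eq_bigr => j _ /=.
by rewrite !mxE rmorphD rmorphM /=; ring.
Qed.

Lemma linformZ p a v : linform p (a *: v) = a%:C * linform p v.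
Proof.
rewrite /linform mulr_sumr; apply: eq_bigr => j _ /=.
by rewrite !mxE rmorphM /=; ring.
Qed.

Lemma linform_comb (c d : C) p q v :
  linform (c *: p + d *: q) v = c * linform p v + d * linform q v.
Proof.
rewrite /linform !mulr_sumr -big_split; apply: eq_bigr => j _ /=.
by rewrite !mxE; ring.
Qed.

Lemma linform_basis p (j : 'I_n) : linform p (basis_vec j) = p 0 j.
Proof.
rewrite /linform (bigD1 j)//= big1 ?addr0 => [|i ij]; last first.
  by rewrite !mxE (negbTE ij) mulr0.
by rewrite !mxE !eqxx mulr1.
Qed.

Lemma linform_eq0 p : (forall v, linform p v = 0) -> p = 0.
Proof. by move=> h; apply/rowP => j; rewrite mxE -linform_basis h. Qed.

Lemma linform_neq0 p : p != 0 -> exists v, linform p v != 0.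
Proof.
move=> /rV0Pn[j pj]; exists (basis_vec j).
by rewrite linform_basis.
Qed.

Lemma normalize v : v != 0 -> exists s : R, s != 0 /\ dot (s *: v) (s *: v) = 1.
Proof.
move=> v0; have d0 : 0 < dot v v.
  rewrite lt_def; apply/andP; split.
    by apply: contraNneq v0 => /dot_eq0 ->.
  by apply: sumr_ge0 => j _; rewrite -expr2 sqr_ge0.
exists (Num.sqrt (dot v v))^-1; split.
  by rewrite invr_eq0 gt_eqF// sqrtr_gt0.
by rewrite dotZZ -expr2 exprVn sqr_sqrtr ?ltW// mulVf// gt_eqF.
Qed.

(** Polynomial functions on real space, encoded by their restrictions to lines:
    this makes stability under sums and products immediate and reduces the
    cancellation of a factor to polynomials in one variable. *)
Definition polyline G : Prop :=
  forall v w, exists P : {poly C}, forall t : R, G (v + t *: w) = P.[t%:C].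

Lemma polyline_linform p : polyline (linform p).
Proof.
move=> v w; exists ((linform p v)%:P + linform p w *: 'X) => t.
by rewrite addrC linform_lin !hornerE; ring.
Qed.

Lemma polylineM G H : polyline G -> polyline H -> polyline (fun v => G v * H v).
Proof.
move=> hG hH v w; have [[P hP] [P' hP']] := (hG v w, hH v w).
by exists (P * P') => t; rewrite hP hP' hornerM.
Qed.

Lemma polylineD G H : polyline G -> polyline H -> polyline (fun v => G v + H v).
Proof.
move=> hG hH v w; have [[P hP] [P' hP']] := (hG v w, hH v w).
by exists (P + P') => t; rewrite hP hP' hornerD.
Qed.

Lemma polylineZ c G : polyline G -> polyline (fun v => c * G v).
Proof.
move=> hG v w; have [P hP] := hG v w.
by exists (c *: P) => t; rewrite hP hornerZ.
Qed.

Lemma polyline_dot : polyline (fun v => (dot v v)%:C).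
Proof.
move=> v w; exists ((dot v v)%:C%:P + (dot v w + dot v w)%:C *: 'X
                    + (dot w w)%:C *: 'X^2) => t.
rewrite addrC dot_linl !dot_linr !hornerE (dotC w v).
by rewrite !(rmorphD, rmorphM) /=; ring.
Qed.

Lemma polyline_quadric q (c d : C) :
  polyline (fun v => c * (dot v v)%:C + d * linform q v ^+ 2).
Proof.
apply: polylineD; apply: polylineZ; first exact: polyline_dot.
rewrite (_ : (fun v => _) = fun v => linform q v * linform q v)//.
by apply: polylineM; exact: polyline_linform.
Qed.

Lemma poly_real_eq0 (P : {poly C}) : (forall t : R, P.[t%:C] = 0) -> P = 0.
Proof.
move=> h; apply/eqP/negPn/negP => P0.
have : (size [seq (k%:R : R)%:C | k <- iota 0 (size P)] < size P)%N.
  apply: max_poly_roots => //.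
    by apply/allP => x /mapP[k _ ->]; apply/eqP.
  rewrite map_inj_uniq ?iota_uniq// => k l /complexI/eqP.
  by rewrite eqr_nat => /eqP.
by rewrite size_map size_iota ltnn.
Qed.

(** On a line through [v] along which [linform q] is not constant, the product
    is a polynomial in one variable with infinitely many zeros. As [R[i]] is a
    field, one of its two factors is zero, and it is not the first. *)
Lemma linform_mul_eq0 q G : q != 0 -> polyline G ->
  (forall v, linform q v * G v = 0) -> forall v, G v = 0.
Proof.
move=> /linform_neq0[w qw] hG h v.
have [P hP] := hG v w; have [L hL] := polyline_linform q v w.
have /eqP : L * P = 0 by apply: poly_real_eq0 => t; rewrite hornerM -hL -hP.
have v0 : v = v + (0 : R) *: w by rewrite scale0r addr0.
rewrite mulf_eq0 => /orP[/eqP L0|/eqP P0]; last by rewrite v0 hP P0 horner0.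
have := hL 1.
rewrite scale1r L0 horner0 -[v + w]addrC -{1}[w]scale1r linform_lin.
have := hL 0; rewrite -v0 L0 horner0 => ->.
by rewrite rmorph1 mul1r addr0 => /eqP; rewrite (negbTE qw).
Qed.

Lemma ord_neq (i : 'I_n) : (2 <= n)%N -> exists j : 'I_n, j != i.
Proof.
move=> n2; have /card_gt1P[x [y [_ _ xy]]] : (1 < #|'I_n|)%N by rewrite card_ord.
by have [xi|xi] := eqVneq x i; [exists y; rewrite -xi eq_sym|exists x].
Qed.

(** The basis vectors give [c = - d * q_j ^ 2] for all [j], and their sums give
    [d * q_i * q_j = 0] for [i != j]. A nonzero [d] would make every [q_j] but
    one vanish, hence [c], hence the remaining one. *)
Lemma quadric_eq0 q (c d : C) : (2 <= n)%N -> q != 0 ->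
  (forall v, c * (dot v v)%:C + d * linform q v ^+ 2 = 0) -> c = 0 /\ d = 0.
Proof.
move=> n2 /rV0Pn[i qi] h.
have db (j : 'I_n) : dot (basis_vec j) (basis_vec j) = 1.
  by rewrite dot_basis mxE !eqxx.
have hb j : c + d * q 0 j ^+ 2 = 0.
  by rewrite -linform_basis -[c]mulr1 -(h (basis_vec j)) db.
suff d0 : d = 0 by split => //; have := hb i; rewrite d0 mul0r addr0.
have [j ij] := ord_neq i n2.
have := h (1 *: basis_vec i + basis_vec j).
rewrite linform_lin dot_linl !dot_linr !db (dotC (basis_vec j)) !dot_basis.
rewrite !linform_basis.
rewrite [basis_vec i j 0]mxE (negbTE ij) /= mulr0 add0r !mulr1 addr0.
rewrite rmorph1 mul1r => hij.
have cross : d * (q 0 i * q 0 j) = 0.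
  have : 2 * (d * (q 0 i * q 0 j)) = 0.
    rewrite -[RHS]hij rmorphD rmorph1.
    transitivity (2 * (d * (q 0 i * q 0 j)) + (c + d * q 0 i ^+ 2)
                  + (c + d * q 0 j ^+ 2)).
      by rewrite !hb !addr0.
    by ring.
  by move/eqP; rewrite mulf_eq0 pnatr_eq0 => /eqP.
apply/eqP/negPn/negP => d0; move/eqP: cross.
rewrite !mulf_eq0 (negbTE d0) (negbTE qi) /= => /eqP qj.
have := hb j; rewrite qj expr0n mulr0 addr0 => c0.
by have /eqP := hb i; rewrite c0 add0r mulf_eq0 (negbTE d0) expf_eq0 (negbTE qi).
Qed.

Lemma free_pair p q (c d : C) :
  free [:: p; q] -> c *: p + d *: q = 0 -> c = 0 /\ d = 0.
Proof.
move=> /(@freeP _ _ 2 (in_tuple [:: p; q])) h e.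
have := h (fun i => if i == 0 then c else d).
rewrite big_ord_recl big_ord1 /= => /(_ e) hk.
by split; [exact: (hk 0)|exact: (hk 1)].
Qed.

Lemma free_pair_neq0r p q : free [:: p; q] -> q != 0.
Proof.
move=> pq; apply/eqP => q0; have [] := @free_pair p q 0 1 pq.
  by rewrite q0 scale0r scaler0 addr0.
by move=> _ /eqP; rewrite oner_eq0.
Qed.

Lemma free_pair_orth p q : (3 <= n)%N ->
  exists2 z, z != 0 & bilin p z = 0 /\ bilin q z = 0.
Proof.
move=> n3; pose A := (col_mx p q)^T.
have : kermx A != 0.
  rewrite -mxrank_eq0 mxrank_ker subn_eq0 -ltnNge.
  by apply: leq_ltn_trans n3; exact: rank_leq_col.
move/rowV0Pn => [z /sub_kermxP zA z0]; exists z => //.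
move: zA; rewrite /A tr_col_mx mul_mx_row => /eqP; rewrite row_mx_eq0.
have E r : bilin r z = (z *m r^T) 0 0.
  by rewrite mxE; apply: eq_bigr => k _; rewrite !mxE mulrC.
by move=> /andP[/eqP zp /eqP zq]; rewrite !E zp zq mxE.
Qed.

(** Let [A] and [B] be the coefficients of [linform p u] and [linform q u]. For
    fixed [v], the vector [w = A p + B q] is orthogonal to the real complement
    of [v], so it is a multiple of [v]. As [n >= 3] there is a nonzero [z]
    orthogonal to [p] and [q], thus to [w]: if [z] and [v] are not orthogonal
    then [w = 0], and [A = B = 0] because [p] and [q] are independent.
    Therefore [linform q v * linform z v] kills [A] and [B] for every [v]; the
    linear factors can be cancelled, and [quadric_eq0] applies to [A]. *)
Lemma pencil_eq0 p q (c d c1 c2 : C) : (3 <= n)%N -> free [:: p; q] ->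
  (forall u v, dot u u = 1 -> dot v v = 1 -> dot u v = 0 -> linform q v != 0 ->
     (c + d * linform q v ^+ 2) * linform p u +
     linform q v * (c1 * linform p v + c2 * linform q v) * linform q u = 0) ->
  [/\ c = 0, d = 0, c1 = 0 & c2 = 0].
Proof.
move=> n3 pq h.
(* A and B homogeneous of degree two, so that v can be rescaled *)
pose A v := c * (dot v v)%:C + d * linform q v ^+ 2.
pose B v := linform q v * (c1 * linform p v + c2 * linform q v).
have {}h u v : dot u v = 0 -> linform q v != 0 ->
    A v * linform p u + B v * linform q u = 0.
  move=> uv qv.
  have [->|u0] := eqVneq u 0.
    by rewrite -(scale0r 0) !linformZ rmorph0 !mul0r !mulr0 addr0.
  have v0 : v != 0.
    by apply: contraNneq qv => ->; rewrite -(scale0r 0) linformZ rmorph0 mul0r.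
  have [s [s0 us]] := normalize u0; have [t [t0 vt]] := normalize v0.
  have qtv : linform q (t *: v) != 0.
    by rewrite linformZ mulf_neq0// real_complex_eq0.
  have := h _ _ us vt _ qtv; rewrite dotZZ uv mulr0 => /(_ erefl).
  rewrite !linformZ -[c]mulr1 -(rmorph1 (real_complex R)) -vt dotZZ => e.
  have : (s * (t * t))%:C * (A v * linform p u + B v * linform q u) = 0.
    by rewrite -[RHS]e /A /B !rmorphM /=; ring.
  move/eqP; rewrite mulf_eq0 real_complex_eq0 !mulf_eq0.
  by rewrite (negbTE s0) (negbTE t0) => /eqP.
have [z z0 [pz qz]] := free_pair_orth p q n3.
have q0 : q != 0 := free_pair_neq0r pq.
have AB v : linform q v != 0 -> linform z v != 0 -> A v = 0 /\ B v = 0.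
  move=> qv zv; pose w := A v *: p + B v *: q.
  have key j : (dot v v)%:C * w 0 j = (v j 0)%:C * linform w v.
    (* the component of |v|^2 e_j orthogonal to v *)
    have := h (dot v v *: basis_vec j + - v j 0 *: v) v _ qv.
    rewrite dot_linl dotZl (dotC (basis_vec j)) dot_basis => /(_ _) e0.
    have {e0} := e0 ltac:(ring).
    rewrite !linform_lin !linformZ !linform_basis => e.
    apply/eqP; rewrite -subr_eq0.
    rewrite linform_comb !mxE -[X in _ == X]e rmorphN; apply/eqP; ring.
  have dv0 : dot v v != 0.
    apply: contraNneq qv => /dot_eq0 ->.
    by rewrite -(scale0r 0) linformZ rmorph0 mul0r.
  have wz : linform w v * linform z v = 0.
    transitivity ((dot v v)%:C * (A v * bilin p z + B v * bilin q z)).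
      rewrite [linform z v]/linform mulr_sumr /bilin !mulr_sumr.
      rewrite -big_split mulr_sumr.
      apply: eq_bigr => j _ /=.
      transitivity (z 0 j * ((v j 0)%:C * linform w v)); first by ring.
      by rewrite -key !mxE; ring.
    by rewrite pz qz !mulr0 addr0 mulr0.
  have /eqP w0 : w == 0.
    apply/eqP/rowP => j; rewrite [RHS]mxE; have /eqP := key j.
    move: wz => /eqP; rewrite mulf_eq0 (negbTE zv) orbF => /eqP ->.
    by rewrite mulr0 mulf_eq0 real_complex_eq0 (negbTE dv0) => /eqP ->.
  exact: free_pair pq w0.
have polyA : polyline A by exact: polyline_quadric.
have polyr : polyline (linform (c1 *: p + c2 *: q)) by exact: polyline_linform.
have vanish v : linform q v * (linform z v * A v) = 0 /\
    linform q v * (linform z v * B v) = 0.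
  have [->|qv] := eqVneq (linform q v) 0; first by rewrite !mul0r.
  have [->|zv] := eqVneq (linform z v) 0; first by rewrite !mul0r !mulr0.
  by have [-> ->] := AB v qv zv; rewrite !mulr0.
have A0 v : A v = 0.
  apply: (linform_mul_eq0 z0 polyA) => {}v.
  apply: (linform_mul_eq0 q0 (polylineM (polyline_linform z) polyA)) => {}v.
  by have [] := vanish v.
have [c0 d0] := quadric_eq0 (ltnW n3) q0 A0.
have r0 : c1 *: p + c2 *: q = 0.
  apply: linform_eq0 => v; apply: (linform_mul_eq0 q0 polyr) => {}v.
  apply: (linform_mul_eq0 z0 (polylineM (polyline_linform q) polyr)) => {}v.
  apply: (linform_mul_eq0 q0 (polylineM (polyline_linform z)
    (polylineM (polyline_linform q) polyr))) => {}v.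
  by have [_] := vanish v; rewrite /B linform_comb.
by have [-> ->] := free_pair pq r0.
Qed.

End RealLocus.

(** * Columns of special orthogonal matrices *)

Section Columns.
Variables (R : realType) (n : nat).
Notation C := (R[i]).
Notation V := ('cV[R]_n).
Notation M := ('M[R]_n).
Implicit Types (u v w : V) (x : M) (i j k : 'I_n).
Local Notation ev := (@basis_vec R n).

Lemma dotE u v : u^T *m v = (dot u v)%:M.
Proof.
apply/matrixP => a b; rewrite !ord1 !mxE mulr1n; apply: eq_bigr => k _.
by rewrite mxE.
Qed.

Lemma dot_mulmx (A : M) u v : dot (A *m u) v = dot u (A^T *m v).
Proof.
have := dotE (A *m u) v; rewrite trmx_mul -mulmxA dotE => /matrixP/(_ 0 0).
by rewrite !mxE !mulr1n.
Qed.

Lemma col_basis (A : M) j : A *m (ev j) = col j A.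
Proof. by rewrite colE. Qed.

(** The Householder reflection along [w]; it is the identity for [w = 0], since
    [0^-1 = 0]. *)
Definition reflection w : M := 1%:M - (2 / dot w w) *: (w *m w^T).

Lemma reflectionE w v : reflection w *m v = v - (2 * dot w v / dot w w) *: w.
Proof.
rewrite /reflection mulmxBl mul1mx -scalemxAl -mulmxA dotE mul_mx_scalar.
rewrite scalerA.
by congr (_ - _ *: _); ring.
Qed.

Lemma reflection_tr w : (reflection w)^T = reflection w.
Proof. by rewrite /reflection linearB /= linearZ /= trmx1 trmx_mul trmxK. Qed.

Lemma reflectionK w : reflection w *m reflection w = 1%:M.
Proof.
rewrite {2}/reflection mulmxBr mulmx1 -scalemxAr mulmxA reflectionE.
have [d0|d0] := eqVneq (dot w w) 0.
  rewrite d0 invr0 mulr0 scale0r subr0 /reflection.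
  by rewrite d0 invr0 mulr0 scale0r subr0.
rewrite mulfK// mulmxBl -scalemxAl /reflection.
by apply/matrixP => a b; rewrite !mxE; ring.
Qed.

Lemma reflection_swap u v : dot u u = dot v v -> reflection (u - v) *m u = v.
Proof.
move=> uv; rewrite reflectionE.
have [/dot_eq0/eqP d0|d0] := eqVneq (dot (u - v) (u - v)) 0.
  by move: d0; rewrite subr_eq0 => /eqP ->; rewrite subrr scaler0 subr0.
have e : 2 * dot (u - v) u = dot (u - v) (u - v).
  rewrite -[u - v]addrC -scaleN1r !dot_linl !dot_linr (dotC v u) uv; ring.
by rewrite e divff// scale1r subKr.
Qed.

Lemma reflection_fix w v : dot w v = 0 -> reflection w *m v = v.
Proof. by move=> wv; rewrite reflectionE wv mulr0 mul0r scale0r subr0. Qed.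

Definition flip k : M := diag_mx (\row_j (if j == k then -1 else 1)).

(** Changing the sign of column [k] changes the sign of the determinant. *)
Lemma SO_of_orthogonal x k : x *m x^T = 1%:M ->
  exists y, SO y /\ forall j, j != k -> col j y = col j x.
Proof.
move=> xx; have : \det x ^+ 2 == 1.
  by rewrite expr2 -{2}det_tr -det_mulmx xx det1.
rewrite sqrf_eq1 => /orP[/eqP dx|/eqP dx]; first by exists x.
exists (x *m flip k); split; [split|].
- rewrite trmx_mul mulmxA -(mulmxA x) (_ : flip k *m _ = 1%:M) ?mulmx1//.
  rewrite tr_diag_mx mulmx_diag -diag_const_mx; congr diag_mx.
  by apply/rowP => j; rewrite !mxE; case: ifP => _; rewrite ?mulr1 ?mulrNN ?mulr1.
- rewrite det_mulmx dx det_diag (bigD1 k)//= mxE eqxx big1 => [|j /negbTE jk].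
    by rewrite mulr1 mulrNN mulr1.
  by rewrite mxE jk.
- move=> j /negbTE jk; rewrite -!col_basis -mulmxA; congr (_ *m _).
  apply/colP => l; rewrite mul_diag_mx !mxE.
  by have [->|] := eqVneq l j; rewrite ?jk ?mul1r //= mulr0.
Qed.

Lemma SO_column v i : (2 <= n)%N -> dot v v = 1 -> exists x, SO x /\ col i x = v.
Proof.
move=> n2 vv; have [k ki] := ord_neq i n2.
have ee : dot (ev i) (ev i) = 1 by rewrite dot_basis mxE !eqxx.
have [|y [ySO yc]] := @SO_of_orthogonal (reflection ((ev i) - v)) k.
  by rewrite reflection_tr reflectionK.
exists y; split => //; rewrite yc 1?eq_sym// -col_basis reflection_swap//.
by rewrite ee vv.
Qed.

(** One reflection [H1] sends [e_j] to [v]; a second one sends [e_i] to [H1 u]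
    and fixes [e_j], which is orthogonal to both. A third column is left to adjust
    the determinant. *)
Lemma SO_columns u v i j : (3 <= n)%N -> i != j ->
  dot u u = 1 -> dot v v = 1 -> dot u v = 0 ->
  exists x, [/\ SO x, col i x = u & col j x = v].
Proof.
move=> n3 ij uu vv uv.
have [k] : exists k, k \notin [set i; j]%SET.
  apply/existsP; rewrite -negb_forall; apply/negP => /forallP h.
  have : (#|'I_n| <= #|[set i; j]%SET|)%N.
    by apply/subset_leq_card/fintype.subsetP => k _; exact: h.
  by rewrite card_ord cards2 ij leqNgt n3.
rewrite !inE negb_or => /andP[ki kj].
have ee l : dot (ev l) (ev l) = 1 by rewrite dot_basis mxE !eqxx.
pose H1 := reflection ((ev j) - v).
have H1j : H1 *m (ev j) = v by rewrite reflection_swap ?ee.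
pose u' := H1 *m u.
have u'1 : dot u' u' = 1.
  by rewrite dot_mulmx reflection_tr mulmxA reflectionK mul1mx.
have u'j : dot u' (ev j) = 0 by rewrite dot_mulmx reflection_tr H1j.
pose H2 := reflection ((ev i) - u').
have H2i : H2 *m (ev i) = u' by rewrite reflection_swap ?ee.
have H2j : H2 *m (ev j) = (ev j).
  apply: reflection_fix; rewrite addrC -scaleN1r dot_linl u'j mulr0 add0r.
  by rewrite dotC dot_basis mxE (negbTE ij).
have [|y [ySO yc]] := @SO_of_orthogonal (H1 *m H2) k.
  rewrite trmx_mul !reflection_tr mulmxA -(mulmxA H1) reflectionK mulmx1.
  by rewrite reflectionK.
exists y; split => //; rewrite yc 1?eq_sym// -col_basis -mulmxA.
  by rewrite H2i mulmxA reflectionK mul1mx.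
by rewrite H2j.
Qed.

Lemma colform_col (p : 'rV[C]_n) i x : colform p i x = linform p (col i x).
Proof. by apply: eq_bigr => j _; rewrite mxE. Qed.

End Columns.

(** * The nonvanishing locus is open and dense *)

Section OpenDense.
Variables (R : realType) (n : nat).
Notation C := (R[i]).
Notation M := ('M[R]_n).
Implicit Types (x y : M) (i j k : 'I_n).

Section Rotation.
Variables i j : 'I_n.
Hypothesis ij : i != j.

Definition rot_skew : M := delta_mx j i - delta_mx i j.
Definition rot_proj : M := delta_mx i i + delta_mx j j.
(** The rotation by [t] in the plane of [e_i] and [e_j]: [rot_skew] generates it
    and [rot_proj] is the projection onto the plane. *)
Definition rotation (t : R) : M :=
  1%:M + sin t *: rot_skew + (cos t - 1) *: rot_proj.

Let ji : j != i. Proof. by rewrite eq_sym. Qed.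

Lemma rot_skew2 : rot_skew *m rot_skew = - rot_proj.
Proof.
rewrite /rot_skew /rot_proj mulmxBl !mulmxBr !mul_delta_mx_cond !eqxx.
by rewrite (negbTE ij) (negbTE ji) !mulr0n !mulr1n sub0r subr0 opprD addrC.
Qed.

Lemma rot_proj2 : rot_proj *m rot_proj = rot_proj.
Proof.
rewrite /rot_proj mulmxDl !mulmxDr !mul_delta_mx_cond !eqxx.
by rewrite (negbTE ij) (negbTE ji) !mulr0n !mulr1n add0r addr0.
Qed.

Lemma rot_skew_proj : rot_skew *m rot_proj = rot_skew.
Proof.
rewrite /rot_skew /rot_proj mulmxBl !mulmxDr !mul_delta_mx_cond !eqxx.
by rewrite (negbTE ij) (negbTE ji) !mulr0n !mulr1n addr0 add0r.
Qed.

Lemma rot_proj_skew : rot_proj *m rot_skew = rot_skew.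
Proof.
rewrite /rot_skew /rot_proj mulmxDl !mulmxBr !mul_delta_mx_cond !eqxx.
by rewrite (negbTE ij) (negbTE ji) !mulr0n !mulr1n sub0r subr0 addrC.
Qed.

Lemma rotationD s t : rotation s *m rotation t = rotation (s + t).
Proof.
rewrite /rotation sinD cosD !mulmxDl !mulmxDr !mul1mx !mulmx1.
rewrite -!scalemxAl -!scalemxAr rot_skew2 rot_proj2 rot_skew_proj rot_proj_skew.
by apply/matrixP => a b; rewrite !mxE; ring.
Qed.

Lemma rotation_tr t : (rotation t)^T = rotation (- t).
Proof.
rewrite /rotation sinN cosN; apply/matrixP => a b; rewrite !mxE.
by rewrite [b == a]eq_sym ![(b == _) && _]andbC; ring.
Qed.

Lemma rotation0 : rotation 0 = 1%:M.
Proof. by rewrite /rotation sin0 cos0 subrr !scale0r !addr0. Qed.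

(** The determinant is 1 because the rotation is the square of the rotation by
    half the angle. *)
Lemma rotation_SO t : SO (rotation t).
Proof.
split; first by rewrite rotation_tr rotationD subrr rotation0.
have -> : t = t / 2 + t / 2 by field.
rewrite -rotationD det_mulmx -{2}det_tr -det_mulmx rotation_tr rotationD.
by rewrite subrr rotation0 det1.
Qed.

Lemma colform_rotation (q : 'rV[C]_n) x t : colform q i (x *m rotation t) =
  (cos t)%:C * colform q i x + (sin t)%:C * colform q j x.
Proof.
rewrite colform_mulmx (bigD1 i)//= (bigD1 j)//= big1 ?addr0 => [|k /andP[ki kj]].
  rewrite !mxE !eqxx (negbTE ij) (negbTE ji) /= !(mulr0n, mulr1n).
  by ring.
by rewrite !mxE (negbTE ki) (negbTE kj) /=; ring.
Qed.

End Rotation.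

Lemma SO_mul x y : SO x -> SO y -> SO (x *m y).
Proof.
move=> [x1 dx] [y1 dy]; split; last by rewrite det_mulmx dx dy mulr1.
by rewrite trmx_mul mulmxA -(mulmxA x) y1 mulmx1.
Qed.

(** If the form vanishes on column [i] of [x], it does not vanish on some other
    column [j], because [x] is invertible. Rotating these two columns by a small
    angle [t > 0] gives the value [sin t * colform q j x] on column [i]. *)
Lemma SO_nonzero_dense (q : 'rV[C]_n) i : q != 0 ->
  @SO R n `<=` closure (SO_nonzero (colform q i)).
Proof.
move=> q0 x xSO B Bx.
have [Qx|Qx] := eqVneq (colform q i x) 0; last first.
  by exists x; split; [split => //; exact/eqP|exact: nbhs_singleton].
have [j Qj] : exists j, colform q j x != 0.
  apply: contrapT => /forallNP h; move/eqP: q0; apply.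
  have {}h k : colform q k x = 0 by apply/eqP/negPn/negP => /h.
  have qx : q *m map_mx (real_complex R) x = 0.
    apply/rowP => k; rewrite !mxE -[RHS](h k).
    by apply: eq_bigr => l _; rewrite mxE.
  have [xx _] := xSO.
  rewrite -[q]mulmx1 -(map_mx1 (real_complex R)) -xx map_mxM mulmxA qx.
  by rewrite mul0mx.
have ij : i != j by apply: contraNneq Qj => <-; rewrite Qx.
have cvgrot : x *m rotation i j t @[t --> (0 : R)^'+] --> x.
  have cvg0 : x *m rotation i j t @[t --> (0 : R)] --> x *m rotation i j 0.
    have E t : x *m rotation i j t = x + sin t *: (x *m rot_skew i j)
        + (cos t - 1) *: (x *m rot_proj i j).
      rewrite /rotation; move: (rot_skew i j) (rot_proj i j) => A D.
      by rewrite !mulmxDr mulmx1 -!scalemxAr.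
    under eq_fun do rewrite E.
    rewrite E; apply: cvgD; [apply: cvgD; [exact: cvg_cst|]|]; apply: cvgZr_tmp.
      exact: continuous_sin.
    by apply: cvgB; [exact: continuous_cos|exact: cvg_cst].
  by rewrite rotation0 mulmx1 in cvg0; exact: cvg_at_right_filter.
have [t [tB tpi t0]] : exists t : R, [/\ B (x *m rotation i j t), t < pi & 0 < t].
  apply: (@filter_ex _ (0 : R)^'+); near=> t; split.
  - by near: t; exact: (cvgrot B Bx).
  - by near: t; apply: nbhs_right_lt; exact: pi_gt0.
  - by near: t; exact: nbhs_right_gt.
exists (x *m rotation i j t); split => //; split.
  by apply: SO_mul => //; exact: rotation_SO.
rewrite colform_rotation// Qx mulr0 add0r => /eqP.
rewrite mulf_eq0 (negbTE Qj) orbF real_complex_eq0.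
by rewrite gt_eqF// sin_gt0_pi// t0.
Unshelve. all: by end_near. Qed.

Lemma colform_open (q : 'rV[C]_n) i : open [set x : M | colform q i x <> 0].
Proof.
have lin_cont (c : 'I_n -> R) : continuous (fun x : M => \sum_j c j * x j i).
  apply: continuous_big => [|j _ x]; first exact: add_continuous.
  exact: cvgMl_tmp (@coord_continuous R n n j i x).
have Re_cont : continuous (fun x : M => complex.Re (colform q i x)).
  rewrite (_ : (fun x : M => _) = fun x => \sum_j complex.Re (q 0 j) * x j i)//.
  apply/funext => x; rewrite complexRe_sum; apply: eq_bigr => j _.
  by rewrite complexReM mulr0 subr0.
have Im_cont : continuous (fun x : M => complex.Im (colform q i x)).
  rewrite (_ : (fun x : M => _) = fun x => \sum_j complex.Im (q 0 j) * x j i)//.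
  apply/funext => x; rewrite complexIm_sum; apply: eq_bigr => j _.
  by rewrite complexImM mulr0 add0r.
rewrite (_ : [set x : M | _] =
   (fun x => complex.Re (colform q i x)) @^-1` [set r | r != 0] `|`
   (fun x => complex.Im (colform q i x)) @^-1` [set r | r != 0]).
  by apply: openU; apply: open_comp => //; exact: open_neq.
apply/seteqP; split => [x /= /eqP|x /= h e].
  by rewrite eq_complex negb_and => /orP.
by case: h; rewrite e eqxx.
Qed.

End OpenDense.

(** * The classification *)

Section OnTheGroup.
Variables (R : realType) (n : nat).
Notation C := (R[i]).
Notation M := ('M[R]_n).
Implicit Types (p q : 'rV[C]_n) (x : M).

Lemma gram_SO p q x : SO x -> gram p q x = bilin p q.
Proof.
move=> [xx _]; have xxE i j : \sum_k x i k * x j k = (i == j)%:R.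
  have /matrixP/(_ i j) := xx; rewrite !mxE => <-.
  by apply: eq_bigr => k _; rewrite mxE.
transitivity (\sum_i \sum_j p 0 i * q 0 j * (\sum_k x i k * x j k)%:C).
  rewrite /gram /colform.
  under eq_bigr => k _ do rewrite mulr_suml.
  rewrite exchange_big; apply: eq_bigr => i _.
  under eq_bigr => k _ do rewrite mulr_sumr.
  rewrite exchange_big; apply: eq_bigr => j _; rewrite rmorph_sum mulr_sumr.
  by apply: eq_bigr => k _; rewrite rmorphM; ring.
apply: eq_bigr => i _; rewrite (bigD1 i)//= xxE eqxx rmorph1 mulr1 big1 ?addr0//.
by move=> j ji; rewrite xxE eq_sym (negbTE ji) rmorph0 mulr0.
Qed.

(** A column of an element of SO(n) is an arbitrary unit vector, so after
    homogenization [r q (c |v|^2 + d q^2)] vanishes on all real vectors. Both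
    linear forms can be cancelled if [r] is nonzero, and then [quadric_eq0]
    applies. *)
Lemma sphere_linform_eq0 q r (i : 'I_n) (c d : C) : (2 <= n)%N -> q != 0 ->
  (forall x, SO x -> colform q i x != 0 ->
     colform r i x * (c + d * colform q i x ^+ 2) = 0) ->
  r = 0 \/ c = 0 /\ d = 0.
Proof.
move=> n2 q0 h; have [->|r0] := eqVneq r 0; first by left.
right; apply: (quadric_eq0 n2 q0) => v.
pose G w := c * (dot w w)%:C + d * linform q w ^+ 2.
have polyG : polyline G by exact: polyline_quadric.
apply: (linform_mul_eq0 r0 polyG) => {}v.
apply: (linform_mul_eq0 q0 (polylineM (polyline_linform r) polyG)) => {}v.
have [->|qv] := eqVneq (linform q v) 0; first by rewrite mul0r.
have v0 : v != 0.
  by apply: contraNneq qv => ->; rewrite -(scale0r 0) linformZ rmorph0 mul0r.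
have [s [s0 vs]] := normalize v0.
have sC : s%:C != 0 :> C by rewrite real_complex_eq0.
have [x [xSO xv]] := SO_column i n2 vs.
have := h x xSO; rewrite !colform_col xv !linformZ => /(_ (mulf_neq0 sC qv)) e.
suff -> : linform r v * G v = 0 by rewrite mulr0.
apply: (mulfI (expf_neq0 3 sC)); rewrite mulr0 -[RHS]e /G.
rewrite -[c in RHS]mulr1 -(rmorph1 (real_complex R)) -vs dotZZ !rmorphM /=; ring.
Qed.

End OnTheGroup.

Theorem theorem5p2 (R : realType) (n : nat) (hn : (3 <= n)%N)
    (p q : 'rV[R[i]]_n) (hpq : free [:: p; q]) (alpha beta : 'I_n) :
  let P := colform p alpha in
  let Q := colform q beta in
  let W := SO_nonzero Q in
  let f := fun x : 'M[R]_n => P x / Q x in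
  [/\ open_dense_in (@SO R n) W,
      harmonic_on W f <->
        [/\ alpha = beta, bilin q q = 0 & bilin p q = 0]
    & proper_biharmonic_on W f <->
        [/\ alpha = beta, bilin q q = 0, bilin p q <> 0 & n = 4%N] \/
        [/\ alpha <> beta, bilin q q = 0 & bilin p q = 0]].
Proof.
move=> P Q W f.
have n2 : (2 <= n)%N := ltnW hn.
have q0 : q != 0 := free_pair_neq0r hpq.
set a := bilin q q; set b := bilin p q.
pose S := colform p beta; pose T := colform q alpha.
pose d : R[i] := (alpha == beta)%:R.
(* Clearing denominators turns both conditions into polynomial ones. *)
have WE x : SO x -> Q x != 0 -> W x by move=> xSO /eqP.
have tauE x : W x -> tau f x * Q x ^+ 3 =
    (S x * T x - d * b) * Q x - P x * Q x ^+ 2 + a * P x.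
  move=> [xSO /eqP Qx]; rewrite (tau_quotient p alpha Qx).
  rewrite !(gram_SO _ _ xSO) -/(S x) -/(T x) -/(P x) -/(Q x) -/a -/b -/d.
  by field.
have ttauE x : W x -> tau (tau f) x * Q x ^+ 5 =
    - d * b * (n%:R - 6) * Q x ^+ 3
    - (2 * b * T x + 2 * d * a * S x - a * (n%:R - 8) * P x) * Q x ^+ 2
    + 6 * a * (S x * T x - d * b) * Q x + 6 * a ^+ 2 * P x.
  move=> [xSO /eqP Qx]; rewrite (tau_tau_quotient p alpha Qx).
  rewrite !(gram_SO _ _ xSO) -/(S x) -/(T x) -/(P x) -/(Q x) -/a -/b -/d.
  by field.
have harmE : harmonic_on W f <-> [/\ alpha = beta, a = 0 & b = 0].
  split=> [h|[ab a0 b0] x Wx]; last first.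
    have [_ /eqP Qx] := Wx; apply: (mulIf (expf_neq0 3 Qx)).
    by rewrite mul0r tauE// a0 b0 /S /T /P /Q ab; ring.
  have [ab|ab] := eqVneq alpha beta.
    (* S = P and T = Q, and the numerator is the linear form a P - b Q *)
    have [] : a *: p + (- b) *: q = 0 \/ (1 : R[i]) = 0 /\ (0 : R[i]) = 0.
      apply: (@sphere_linform_eq0 _ _ q _ beta) => // x xSO Qx.
      have := tauE x (WE x xSO Qx); rewrite h ?mul0r; last exact: WE.
      rewrite /S /T /P /Q /d ab eqxx mulr1n.
      rewrite (colform_col (a *: p + _)) linform_comb -!colform_col.
      by move=> e; rewrite [RHS]e; ring.
    - by move=> /(free_pair hpq)[-> /eqP]; rewrite oppr_eq0 => /eqP.
    - by case=> /eqP; rewrite oner_eq0.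
  (* The numerator is (a - Q^2) P + P_beta Q Q_alpha. *)
  have [] := @pencil_eq0 R n p q a (-1) 1 0 hn hpq _; last first.
    by move=> _ /eqP; rewrite oppr_eq0 oner_eq0.
  move=> u v uu vv uv qv.
  have [x [xSO xu xv]] := SO_columns hn ab uu vv uv.
  have Wx : W x by apply: WE => //; rewrite /Q colform_col xv.
  have := tauE x Wx; rewrite h// mul0r /S /T /P /Q /d (negbTE ab) mulr0n.
  by rewrite !colform_col xu xv => e; rewrite [RHS]e; ring.
have tau_neq0 : ~ [/\ alpha = beta, a = 0 & b = 0] ->
    exists x, W x /\ tau f x <> 0.
  move=> nh; apply: contrapT => /forallNP h; apply: nh; apply/harmE => x Wx.
  by apply: contrapT => tx; apply: (h x).
split => //.
  split; last exact: SO_nonzero_dense.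
  exists [set x : 'M[R]_n | Q x <> 0]; split => //; exact: colform_open.
split.
- move=> [h [x0 [Wx0 tx0]]].
  have [ab|ab] := eqVneq alpha beta; [left|right].
    have nh : ~ (a = 0 /\ b = 0).
      by move=> [a0 b0]; apply: tx0; apply: (iffRL harmE).
    (* S = P and T = Q, and the numerator factors as
       (a P - b Q) ((n - 4) Q^2 + 6 a) *)
    have [] : a *: p + (- b) *: q = 0 \/ 6 * a = 0 /\ (n%:R - 4 : R[i]) = 0.
      apply: (@sphere_linform_eq0 _ _ q _ beta) => // x xSO Qx.
      have := ttauE x (WE x xSO Qx); rewrite h ?mul0r; last exact: WE.
      rewrite /S /T /P /Q /d ab eqxx mulr1n.
      rewrite (colform_col (a *: p + _)) linform_comb -!colform_col.
      by move=> e; rewrite [RHS]e; ring.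
    - move=> /(free_pair hpq)[a0 /eqP].
      by rewrite oppr_eq0 => /eqP b0; case: nh.
    - move=> [/eqP]; rewrite mulf_eq0 pnatr_eq0 /= => /eqP a0 /eqP.
      by rewrite subr_eq0 eqr_nat => /eqP n4; split => // b0; exact: nh.
  have [a20 _ _ b20] : [/\ 6 * a ^+ 2 = 0, a * (n%:R - 8) = 0, 6 * a = 0
      & - 2 * b = 0].
    apply: (@pencil_eq0 R n p q _ _ _ _ hn hpq) => u v uu vv uv qv.
    have [x [xSO xu xv]] := SO_columns hn ab uu vv uv.
    have Wx : W x by apply: WE => //; rewrite /Q colform_col xv.
    have := ttauE x Wx; rewrite h// mul0r /S /T /P /Q /d (negbTE ab) mulr0n.
    by rewrite !colform_col xu xv => e; rewrite [RHS]e; ring.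
  split; first exact/eqP.
    by apply/eqP; move/eqP: a20; rewrite mulf_eq0 pnatr_eq0 expf_eq0.
  by apply/eqP; move/eqP: b20; rewrite mulf_eq0 oppr_eq0 pnatr_eq0.
- case=> [[ab a0 b0 n4]|[/eqP ab a0 b0]]; split.
  + move=> x Wx; have [_ /eqP Qx] := Wx; apply: (mulIf (expf_neq0 5 Qx)).
    by rewrite mul0r ttauE// a0 n4 /S /T /P /Q /d ab eqxx mulr1n; ring.
  + by apply: tau_neq0 => -[_ _].
  + move=> x Wx; have [_ /eqP Qx] := Wx; apply: (mulIf (expf_neq0 5 Qx)).
    by rewrite mul0r ttauE// a0 b0; ring.
  + by apply: tau_neq0 => -[/eqP]; rewrite (negbTE ab).
Qed.
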